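(* Let $d\ge1$, $a>0$, $p\ge1$, and let $\mu\in\mathcal{P}(\mathbb{R}^d)$ satisfy $E:=\int_{\mathbb{R}^d}e^{b|y|^p}\,d\mu(y)<\infty$ for some $b>4^pa$. (a) Suppose that $b>2^{2p+1}a$ if $p\ge d/2$, and $b>4^pda/(d-p)$ if $p<d/2$. Then there is a constant $C>0$ depending only on $d,p,a,b,E$ such that for all integers $N\ge1$, $$\mathbb{E}[\mathcal{E}_{p,a}(\mu,\mu_N)]\le C\begin{cases}N^{-1/2}&\text{if }p>d/2,\\ \log(N+1)N^{-1/2}&\text{if }p=d/2,\\ N^{-p/d}&\text{if }p<d/2.\end{cases}$$ (b) Suppose that $b\in(4^pa,2^{2p+1}a]$ if $p\ge d/2$, and $b\in(4^pa,4^pda/(d-p)]$ if $p<d/2$. Then for every $\varepsilon\in(0,1-4^pa/b)$ there is a constant $C>0$ depending only on $d,p,a,b,E,\varepsilon$ such that for all integers $N\ge1$, $$\mathbb{E}[\mathcal{E}_{p,a}(\mu,\mu_N)]\le CN^{-(1-4^pa/b-\varepsilon)}.$$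
   Context: $\mathcal{P}(\mathbb{R}^d)$ is the set of Borel probability measures on $\mathbb{R}^d$; $|\cdot|$ is the Euclidean norm. $X_1,X_2,\dots$ are i.i.d. with law $\mu$ on a probability space $(\Omega,\mathbb{P})$ with expectation $\mathbb{E}$, and $\mu_N=\frac1N\sum_{i=1}^N\delta_{X_i}$. $\mathcal{E}_{p,a}(\mu,\nu):=\inf_{\pi\in\mathrm{Cpl}(\mu,\nu)}\int_{\mathbb{R}^d\times\mathbb{R}^d}\big(e^{a|x-y|^p}-1\big)\,d\pi(x,y)$, where $\mathrm{Cpl}(\mu,\nu)$ is the set of couplings of $\mu$ and $\nu$. *)

(* Defs.v *)
From HB Require Import structures.
From mathcomp Require Import all_boot all_order all_algebra.
From mathcomp Require Import finmap.
From mathcomp Require Import all_classical all_reals all_analysis.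

Set Implicit Arguments.
Unset Strict Implicit.
Unset Printing Implicit Defensive.

Import Order.TTheory GRing.Theory Num.Theory.
Import numFieldNormedType.Exports.

Local Open Scope classical_set_scope.
Local Open Scope ring_scope.

(* R^d with its Borel sigma-algebra, so that [probability (euclid R d) R] is
   the set of Borel probability measures on R^d. *)
Definition euclid (R : realType) (d : nat) :=
  g_sigma_algebraType (@open 'rV[R]_d).

(* Euclidean norm; the norm that the library puts on row vectors is the
   sup norm. *)
Definition enorm (R : realType) (d : nat) (x : 'rV[R]_d) : R :=
  Num.sqrt (\sum_(i < d) x ord0 i ^+ 2).

Definition euclid_dist (R : realType) (d : nat) (x y : euclid R d) : R :=
  enorm ((x : 'rV[R]_d) - (y : 'rV[R]_d)).

(* The marginals are measures rather than probabilities so that [empirical]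
   needs no proof that N is positive; the couplings being probabilities, a
   marginal of a coupling has mass one. *)
Definition coupling (R : realType) (d : nat)
    (mu nu : {measure set (euclid R d) -> \bar R}) :
    set (probability (euclid R d * euclid R d)%type R) :=
  [set pi | (forall A, measurable A -> pushforward pi fst A = mu A) /\
            (forall A, measurable A -> pushforward pi snd A = nu A)].

(* [exp_cost p a mu nu] is E_{p,a}(mu,nu). As a function of the atoms of an
   empirical measure nu it is lower semicontinuous, hence Borel, so integrating
   it over a sample space gives a genuine expectation. *)
Definition exp_cost (R : realType) (d : nat) (p a : R)
    (mu nu : {measure set (euclid R d) -> \bar R}) : \bar R :=
  ereal_inf
    [set (\int[pi]_z (expR (a * euclid_dist z.1 z.2 `^ p) - 1)%:E)%E
      | pi in coupling mu nu].

(* The samples X_1, ..., X_N are numbered x 0, ..., x (N - 1). *)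
Definition empirical (R : realType) (d : nat) (x : nat -> euclid R d)
    (N : nat) : {measure set (euclid R d) -> \bar R} :=
  mscale ((N%:R : R)^-1)%:nng (msum (fun i => \d_(x i)) N).

Definition mutually_independent (R : realType)
    (dO dT : measure_display) (O : measurableType dO) (T : measurableType dT)
    (P : probability O R) (X : nat -> {RV P >-> T}) : Prop :=
  forall (J : {fset nat}) (A : nat -> set T),
    (forall i, measurable (A i)) ->
    P (\bigcap_(i in [set` J]) (X i @^-1` A i)) =
    (\prod_(i <- J) P (X i @^-1` A i))%E.

Definition iid_with_law (R : realType)
    (dO dT : measure_display) (O : measurableType dO) (T : measurableType dT)
    (P : probability O R) (X : nat -> {RV P >-> T})
    (mu : probability T R) : Prop :=
  mutually_independent X /\
  (forall i A, measurable A -> distribution P (X i) A = mu A).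

Definition rate (R : realType) (d : nat) (p : R) (N : nat) : R :=
  if d%:R / 2 < p then N%:R `^ (- (1 / 2))
  else if p == d%:R / 2 then ln (N.+1)%:R * N%:R `^ (- (1 / 2))
  else N%:R `^ (- (p / d%:R)).

(* Main.v *)
Require Import Defs.
From HB Require Import structures.
From mathcomp Require Import all_boot all_order all_algebra.
From mathcomp Require Import finmap.
From mathcomp Require Import all_classical all_reals all_analysis.
From mathcomp Require Import measurable_realfun ring lra.

(** Fournier-Guillin's dyadic argument, with a semi-discrete coupling built from
    the bottom up. Cut R^d into the annuli A_n = {2^(n-1) < |x| <= 2^n} (A_0 is
    the unit ball) and each annulus, rescaled to the cube [-1,1]^d, into dyadic
    cells of side 2^-l. Starting with the finest cells, match inside each cell as
    much of the remaining mass of mu as possible with the remaining mass of mu_N,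
    then pass to the coarser cells, and finally match what is left in the whole
    space. After the cells of depth l have been treated, the mass left over in a
    cell F is exactly |mu(F) - mu_N(F)|.

    Since |x - y|^p <= 2^((n+1)p) on a ball of radius 2^n, convexity of exp makes
    the cost of a match at depth l in A_n at most of order 2^(-pl) w_n with
    w_n = exp(a 2^((n+1)p)) = exp(4^p a 2^((n-1)p)), and the cost of a match
    between A_m and A_n at most w_m + w_n. The expected deviation summed over the
    2^(dl) cells of depth l in A_n is at most of order
    min(x_n, (2^(dl) x_n / N)^(1/2)), where x_n = mu(A_n) <= E exp(-b 2^((n-1)p)).
    Summing over l gives a bound rho_N x_n^s, where s = 1/2 if p >= d/2 and
    s = 1 - p/d if p < d/2 in (a), s = 4^p a / b + eps in (b). The hypotheses on b
    say exactly that s b > 4^p a, which makes the sum of w_n x_n^s finite. *)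

Set Implicit Arguments.
Unset Strict Implicit.
Unset Printing Implicit Defensive.

Import Order.TTheory GRing.Theory Num.Theory.
Import numFieldNormedType.Exports.
Local Open Scope classical_set_scope.
Local Open Scope ring_scope.

(** * Measures with a density *)

(* The proofs are arguments so that the measure structure can be inferred. *)
Definition with_density d (T : measurableType d) (R : realType)
    (mu : {measure set T -> \bar R}) (g : T -> R)
    (g0 : forall x, 0 <= g x) (mg : measurable_fun setT g) (A : set T) :=
  (\int[mu]_(x in A) (g x)%:E)%E.

Section with_density.
Local Open Scope ereal_scope.
Context d (T : measurableType d) (R : realType)
  (mu : {measure set T -> \bar R}) (g : T -> R)
  (g0 : forall x, (0 <= g x)%R) (mg : measurable_fun setT g).
Local Notation nu := (with_density mu g0 mg).

Let with_density0 : nu set0 = 0.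
Proof. exact: integral_set0. Qed.

Let with_density_ge0 A : 0 <= nu A.
Proof. by apply: integral_ge0 => x _; rewrite lee_fin. Qed.

Let with_density_sigma_additive : semi_sigma_additive nu.
Proof.
move=> /= A mA tA mUA; rewrite /with_density ge0_integral_bigcup//.
- apply: is_cvg_ereal_nneg_natsum_cond => n _ _.
  by apply: integral_ge0 => x _; rewrite lee_fin.
- by apply/measurable_EFinP; exact: measurable_funTS.
- by move=> x _; rewrite lee_fin.
Qed.

HB.instance Definition _ := isMeasure.Build _ _ _
  nu with_density0 with_density_ge0 with_density_sigma_additive.

Import HBNNSimple.

(** Both sides pass to monotone limits and finite nonnegative combinations, so simple functions,
    then indicators, suffice; on an indicator this is the definition of the measure. *)
Lemma ge0_integral_with_density (f : T -> \bar R) : (forall x, 0 <= f x) ->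
  measurable_fun setT f -> \int[nu]_x f x = \int[mu]_x (f x * (g x)%:E).
Proof.
move=> f0 mf; pose h := nnsfun_approx measurableT mf.
have hf x : (EFin \o h n) x @[n --> \oo] --> f x by exact: cvg_nnsfun_approx.
have mh n : measurable_fun setT (EFin \o h n) by exact/measurable_EFinP.
have mEg : measurable_fun setT (EFin \o g) by exact/measurable_EFinP.
have ndh x a b : (a <= b)%N -> (h a x <= h b x)%R.
  by move=> ab; exact/lefP/nd_nnsfun_approx.
have -> : \int[nu]_x f x = lim (\int[nu]_x (EFin \o h n) x @[n --> \oo]).
  rewrite -monotone_convergence//.
  - by apply: eq_integral => x _; apply/esym/cvg_lim.
  - by move=> n x _ //=; rewrite lee_fin.
  - by move=> x _ a b ab; rewrite lee_fin ndh.
have -> : \int[mu]_x (f x * (g x)%:E) =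
    lim (\int[mu]_x ((EFin \o h n) x * (g x)%:E) @[n --> \oo]).
  rewrite -monotone_convergence//.
  - by apply: eq_integral => x _; apply/esym/cvg_lim => //; exact: cvgeZr.
  - by move=> n; apply: emeasurable_funM.
  - by move=> n x _ //=; rewrite mule_ge0 // lee_fin.
  - by move=> x _ a b ab; rewrite lee_wpmul2r ?lee_fin ?ndh.
congr (limn _); apply/funext => n.
transitivity (\int[nu]_x
   (\sum_(y \in range (h n)) (y * \1_(h n @^-1` [set y]) x)%:E)).
  by apply: eq_integral => t tE; rewrite /= fimfunE -fsumEFin.
have mi r : measurable_fun setT (fun x => (r * \1_(h n @^-1` [set r]) x)%:E).
  by apply/measurable_EFinP; exact: measurable_funM.
rewrite ge0_integral_fsum//; last by move=> m y Ey; exact: nnfun_muleindic_ge0.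
transitivity (\int[mu]_x (\sum_(y \in range (h n))
    (y * \1_(h n @^-1` [set y]) x)%:E * (g x)%:E)); last first.
  apply: eq_integral => x _.
  rewrite -ge0_mule_fsuml => [|y]; last exact: nnfun_muleindic_ge0.
  by rewrite fsumEFin // -(fimfunE _ x).
rewrite ge0_integral_fsum//; last 2 first.
  - by move=> y; apply: emeasurable_funM.
  - by move=> m y Ey; rewrite mule_ge0 ?nnfun_muleindic_ge0// lee_fin.
apply: eq_fsbigr => r rhn.
have r0 : (0 <= r)%R by move: rhn; rewrite inE => -[t _ <-].
under eq_integral do rewrite EFinM.
rewrite integralZl_indic_nnsfun //.
under [RHS]eq_integral do rewrite EFinM -muleA.
rewrite ge0_integralZl//.
- rewrite integral_indic// setIT /= /with_density.
  congr (_ * _); rewrite integral_mkcond; apply: eq_integral => x _.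
  by rewrite epatch_indic /= muleC.
- by apply: emeasurable_funM => //; exact/measurable_EFinP.
- by move=> t Et; rewrite mule_ge0 ?lee_fin.
Qed.

End with_density.

(** Countably many labels make every preimage a countable union of cells, so [phi] is arbitrary and
    [K] needs no sigma-algebra. *)
Lemma measurable_label d (T : measurableType d) (K : countType) (R : realType)
    (kap : T -> K) (phi : K -> R) :
  (forall k, measurable (kap @^-1` [set k])) ->
  measurable_fun setT (fun x => phi (kap x)).
Proof.
move=> mk _ B mB; rewrite setTI.
have -> : (fun x => phi (kap x)) @^-1` B =
    \bigcup_(k in [set k | B (phi k)]) (kap @^-1` [set k]).
  apply/seteqP; split => [x Bx|x [k Bk /= kx]]; first by exists (kap x).
  by rewrite /preimage /= kx.
rewrite bigcup_mkcond; apply: countable_bigcupT_measurable => // k.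
by case: ifPn.
Qed.

(** * Greedy coupling with an empirical measure *)

Section plan.
Context d (T : measurableType d) (R : realType) (mu : probability T R)
  (K : countType) (y : nat -> T) (N : nat).

(* A partial coupling of [mu] with the empirical measure of [y 0 .. y (N - 1)]
   that only moves mass inside the cells of [kap]: [h i / N] is the density with
   respect to [mu] of the mass sent to [y i]; [f] and [g i / N] are what remains of
   the density of [mu] and of the atom at [y i]. *)
Record plan (kap : T -> K) (f : T -> R) (g : nat -> R) (h : nat -> T -> R)
    : Prop := Plan {
  plan_mf : measurable_fun setT f;
  plan_f0 : forall x, 0 <= f x;
  plan_g0 : forall i, 0 <= g i;
  plan_mh : forall i, measurable_fun setT (h i);
  plan_h0 : forall i x, 0 <= h i x;
  plan_row : forall x, (N%:R)^-1 * (\sum_(i < N) h i x) + f x = 1;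
  plan_col : forall i, (\int[mu]_x (h i x)%:E + (g i)%:E = 1)%E;
  plan_loc : forall i x, h i x != 0 -> kap x = kap (y i) }.

(** Maximality of the matching in each cell: one of the two sides is used up. On the side of [mu]
    this can only hold almost everywhere, hence the integral. *)
Definition balanced (kap : T -> K) (f : T -> R) (g : nat -> R) :=
  forall k, (\int[mu]_(x in kap @^-1` [set k]) (f x)%:E = 0)%E \/
    forall i, (i < N)%N -> kap (y i) = k -> g i = 0.

Definition plan_cost (c h : nat -> T -> R) : \bar R :=
  (\sum_(i < N) ((N%:R)^-1)%:E * \int[mu]_x (c i x * h i x)%:E)%E.

Lemma integral_cell (kap : T -> K) k (f : T -> R) :
  (\int[mu]_(x in kap @^-1` [set k]) (f x)%:E =
   \int[mu]_x (f x * (kap x == k)%:R)%:E)%E.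
Proof.
rewrite integral_mkcond; apply: eq_integral => x _; rewrite patchE.
have -> : (x \in kap @^-1` [set k]) = (kap x == k).
  by apply/idP/eqP; rewrite inE.
by case: eqP; rewrite ?mulr1 ?mulr0.
Qed.

Lemma plan_f1 kap f g h x : plan kap f g h -> f x <= 1.
Proof.
move=> Pl; rewrite -(plan_row Pl x) lerDr mulr_ge0 ?invr_ge0//.
by apply: sumr_ge0 => i _; exact: (plan_h0 Pl).
Qed.

Lemma measurable_eq_label (kap : T -> K) (k : K) :
  (forall k, measurable (kap @^-1` [set k])) ->
  measurable_fun setT (fun x => (kap x == k)%:R : R).
Proof. by move=> mk; apply: (measurable_label (fun j => (j == k)%:R) mk). Qed.

(* In the cell [k], with [al k] and [be k] left on the two sides, the two remainders
   are matched by [min (al k) (be k)] times the product of their normalizations. *)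
Lemma plan_step (kap kap' : T -> K) f g h (c : nat -> T -> R) (u : T -> R) :
  (0 < N)%N -> plan kap f g h ->
  (forall k, measurable (kap' @^-1` [set k])) ->
  (forall x x', kap x = kap x' -> kap' x = kap' x') ->
  (forall i, measurable_fun setT (c i)) -> (forall i x, 0 <= c i x) ->
  measurable_fun setT u -> (forall x, 0 <= u x) ->
  (forall i x, kap' x = kap' (y i) -> c i x <= u x + u (y i)) ->
  exists f' g' h', [/\ plan kap' f' g' h', balanced kap' f' g' &
    (plan_cost c h' <= plan_cost c h + (\int[mu]_x (u x * f x)%:E +
      (N%:R^-1 * \sum_(i < N) u (y i) * g i)%:E))%E].
Proof.
move=> N0 Pl mk fine_kap mc c0 mu' u0 cu.
have [mf f0 g0 mh h0 row col loc] := Pl.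
have Ninv : 0 <= (N%:R : R)^-1 by rewrite invr_ge0.
have mI k := measurable_eq_label k mk.
pose A k := (\int[mu]_(x in kap' @^-1` [set k]) (f x)%:E)%E.
have A0 k : (0 <= A k)%E by apply: integral_ge0 => x _; rewrite lee_fin.
have A1 k : (A k <= 1)%E.
  apply: (@le_trans _ _ (\int[mu]_(x in kap' @^-1` [set k]) (cst 1 x))%E).
    apply: ge0_le_integral => //.
    - by move=> x _; rewrite lee_fin.
    - by apply/measurable_EFinP; exact: measurable_funTS.
    - by move=> x _; rewrite lee_fin (plan_f1 _ Pl).
  by rewrite integral_cst// mul1e probability_le1.
pose al k := fine (A k).
have alE k : A k = (al k)%:E.
  by rewrite /al fineK// ge0_fin_numE// (le_lt_trans (A1 k))// ltry.
have al0 k : 0 <= al k by rewrite -lee_fin -alE.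
pose be k := N%:R^-1 * \sum_(i < N | kap' (y i) == k) g i.
have be0 k : 0 <= be k by rewrite mulr_ge0 // sumr_ge0.
(* If [al k] or [be k] vanishes, the division by zero yields 0 and nothing is matched in the cell,
   as it should be. *)
pose th k := Num.min (al k) (be k) / (al k * be k).
have th0 k : 0 <= th k.
  by apply: divr_ge0; [rewrite le_min al0 be0|rewrite mulr_ge0].
have alth1 k : al k * th k <= 1.
  rewrite /th; have [->|a0] := eqVneq (al k) 0; first by rewrite mul0r.
  have [->|b0] := eqVneq (be k) 0; first by rewrite !mulr0 invr0 !mulr0.
  have -> : al k * (Num.min (al k) (be k) / (al k * be k)) =
    Num.min (al k) (be k) / be k by field; rewrite a0 b0.
  by rewrite ler_pdivrMr ?lt0r ?b0 ?be0// mul1r ge_min lexx orbT.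
have beth1 k : be k * th k <= 1.
  rewrite /th; have [->|b0] := eqVneq (be k) 0; first by rewrite mul0r.
  have [->|a0] := eqVneq (al k) 0; first by rewrite !mul0r invr0 !mulr0.
  have -> : be k * (Num.min (al k) (be k) / (al k * be k)) =
    Num.min (al k) (be k) / al k by field; rewrite a0 b0.
  by rewrite ler_pdivrMr ?lt0r ?a0 ?al0// mul1r ge_min lexx.
(* The increment of [h i], a multiple of the product of the two remainders. The mass it matches in
   cell [k] is [al k * be k * th k], the minimum of [al k] and [be k]. *)
pose del i x := f x * (kap' x == kap' (y i))%:R * (g i * th (kap' (y i))).
have mdel i : measurable_fun setT (del i).
  by apply: measurable_funM => //; apply: measurable_funM.
have del0 i x : 0 <= del i x by rewrite /del; do !apply: mulr_ge0 => //.
have int_del i : (\int[mu]_x (del i x)%:E =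
    (g i * (al (kap' (y i)) * th (kap' (y i))))%:E)%E.
  under eq_integral do rewrite /del EFinM.
  rewrite ge0_integralZr//; last 3 first.
  - by apply/measurable_EFinP; apply: measurable_funM.
  - by move=> x _; rewrite lee_fin mulr_ge0.
  - by rewrite lee_fin mulr_ge0.
  by rewrite -integral_cell -/(A _) alE -EFinM; congr _%:E; ring.
have sum_del x : N%:R^-1 * (\sum_(i < N) del i x) =
    f x * (be (kap' x) * th (kap' x)).
  rewrite /be [in RHS]big_mkcond /= !(mulr_suml, mulr_sumr).
  apply: eq_bigr => j _; rewrite /del eq_sym.
  by case: (kap' (y j) =P kap' x) => [->|_] /=; ring.
have mbt : measurable_fun setT (fun x => be (kap' x) * th (kap' x)).
  exact: (measurable_label (fun k => be k * th k) mk).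
exists (fun x => f x * (1 - be (kap' x) * th (kap' x))).
exists (fun i => g i * (1 - al (kap' (y i)) * th (kap' (y i)))).
exists (fun i x => h i x + del i x); split.
- split.
  + by apply: measurable_funM => //; apply: measurable_funB.
  + by move=> x; rewrite mulr_ge0// subr_ge0.
  + by move=> i; rewrite mulr_ge0// subr_ge0.
  + by move=> i; apply: measurable_funD.
  + by move=> i x; rewrite addr_ge0.
  + by move=> x; rewrite big_split /= mulrDr sum_del -[RHS](row x); ring.
  + move=> i; under eq_integral do rewrite EFinD.
    rewrite ge0_integralD//; last 4 first.
    * by move=> x _; rewrite lee_fin.
    * exact/measurable_EFinP.
    * by move=> x _; rewrite lee_fin.
    * exact/measurable_EFinP.
    rewrite int_del -[RHS](col i) -addeA -EFinD; congr (_ + _%:E)%E; ring.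
  + move=> i x; have [hx|hx _] := eqVneq (h i x) 0; last first.
      exact/fine_kap/loc.
    rewrite hx add0r /del; case: (kap' x =P kap' (y i)) => // _.
    by rewrite /= !(mulr0, mul0r) eqxx.
(* The smaller side is exhausted: [th k] is then the inverse of the larger amount, so the factor
   left on the smaller side is zero. If the smaller amount is 0, that side was empty before the
   step. *)
- move=> k; have [ab|ba] := leP (al k) (be k).
  + left; rewrite (eq_integral (fun x => (f x)%:E * (1 - be k * th k)%:E)%E).
      rewrite ge0_integralZr//; last 3 first.
      * by apply/measurable_EFinP; exact: measurable_funTS.
      * by move=> x _; rewrite lee_fin.
      * by rewrite lee_fin subr_ge0.
      rewrite -/(A k) alE -EFinM; congr _%:E.
      have [->|a0] := eqVneq (al k) 0; first by rewrite mul0r.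
      have b0 : be k != 0 by rewrite gt_eqF// (lt_le_trans _ ab)// lt0r a0 al0.
      by rewrite /th (min_idPl ab); field; rewrite a0 b0.
    by move=> x; rewrite inE /= => ->; rewrite EFinM.
  + right=> i iN ki; rewrite ki.
    have [b0|b0] := eqVneq (be k) 0.
      move/eqP: b0; rewrite /be mulf_eq0 invr_eq0 pnatr_eq0 -leqn0 leqNgt N0 /=.
      rewrite psumr_eq0// => /allP /(_ (Ordinal iN)).
      by rewrite mem_index_enum ki eqxx => /(_ isT) /eqP /= ->; rewrite mul0r.
    have a0 : al k != 0 by rewrite gt_eqF// (le_lt_trans _ ba).
    by rewrite /th (min_idPr (ltW ba)); field; rewrite a0 b0.
- rewrite /plan_cost.
  have mE (k : nat -> T -> R) i : measurable_fun setT (k i) ->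
      measurable_fun setT (fun x => (c i x * k i x)%:E).
    by move=> ?; apply/measurable_EFinP; apply: measurable_funM.
  have -> : (\sum_(i < N) (N%:R^-1)%:E *
        (\int[mu]_x (c i x * (h i x + del i x))%:E) =
      \sum_(i < N) (N%:R^-1)%:E * (\int[mu]_x (c i x * h i x)%:E) +
      \sum_(i < N) (N%:R^-1)%:E * (\int[mu]_x (c i x * del i x)%:E))%E.
    rewrite -big_split /=; apply: eq_bigr => i _.
    rewrite -ge0_muleDr ?integral_ge0//; last 2 first.
    * by move=> x _; rewrite lee_fin mulr_ge0.
    * by move=> x _; rewrite lee_fin mulr_ge0.
    rewrite -ge0_integralD//.
    * by congr (_ * _)%E; apply: eq_integral => x _; rewrite mulrDr EFinD.
    * by move=> x _; rewrite lee_fin mulr_ge0.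
    * exact: mE.
    * by move=> x _; rewrite lee_fin mulr_ge0.
    * exact: mE.
  rewrite leeD2l//.
  (* Bounding [c i x] by [u x + u (y i)] separates the cost of the increment into a part on [mu] and
     a part on the atoms. Each is at most the integral of [u] against the previous remainder of that
     side, since [be * th] and [al * th] are at most 1. *)
  apply: (@le_trans _ _ (\sum_(i < N) (N%:R^-1)%:E *
    (\int[mu]_x (u x * del i x)%:E + (u (y i) * g i)%:E))%E).
    apply: lee_sum => i _; rewrite lee_wpmul2l ?lee_fin//.
    apply: (@le_trans _ _
        (\int[mu]_x ((u x * del i x)%:E + (u (y i))%:E * (del i x)%:E))%E).
      apply: ge0_le_integral => //.
      + by move=> x _; rewrite lee_fin mulr_ge0.
      + exact: mE.
      + apply: emeasurable_funD; apply/measurable_EFinP; exact: measurable_funM.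
      + move=> x _; rewrite -EFinM -EFinD lee_fin -mulrDl.
        rewrite /del; case: eqP => [kx|]; last by rewrite mulr0 mul0r !mulr0.
        by apply: ler_wpM2r; [do !apply: mulr_ge0 => //|exact: cu].
    rewrite ge0_integralD//; last 4 first.
    * by move=> x _; rewrite lee_fin mulr_ge0.
    * by apply/measurable_EFinP; exact: measurable_funM.
    * by move=> x _; rewrite mule_ge0 ?lee_fin.
    * by apply/measurable_EFinP; exact: measurable_funM.
    rewrite leeD2l// ge0_integralZl ?lee_fin//; last 2 first.
    * exact/measurable_EFinP.
    * by move=> x _; rewrite lee_fin.
    by rewrite int_del -EFinM lee_fin ler_wpM2l// ler_piMr.
  have -> : (\sum_(i < N) (N%:R^-1)%:E *
      (\int[mu]_x (u x * del i x)%:E + (u (y i) * g i)%:E) =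
    \sum_(i < N) (\int[mu]_x (N%:R^-1 * (u x * del i x))%:E) +
      (N%:R^-1 * \sum_(i < N) u (y i) * g i)%:E)%E.
    rewrite mulr_sumr -sumEFin -big_split /=; apply: eq_bigr => i _.
    rewrite ge0_muleDr ?lee_fin ?mulr_ge0 ?integral_ge0//; last first.
      by move=> x _; rewrite lee_fin mulr_ge0.
    rewrite -EFinM; congr (_ + _)%E.
    under [RHS]eq_integral do rewrite EFinM.
    rewrite ge0_integralZl ?lee_fin//.
    * by apply/measurable_EFinP; exact: measurable_funM.
    * by move=> x _; rewrite lee_fin mulr_ge0.
  rewrite leeD2r// -ge0_integral_sum//; last 2 first.
  + move=> i; apply/measurable_EFinP; apply: measurable_funM => //.
    exact: measurable_funM.
  + by move=> i x _; rewrite lee_fin; do !apply: mulr_ge0 => //.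
  apply: ge0_le_integral => //.
  + by move=> x _; apply: sume_ge0 => i _; rewrite lee_fin; do !apply: mulr_ge0 => //.
  + apply: emeasurable_sum => i; apply/measurable_EFinP; apply: measurable_funM => //.
    exact: measurable_funM.
  + by apply/measurable_EFinP; exact: measurable_funM.
  + move=> x _; rewrite sumEFin lee_fin.
    have -> : \sum_(i < N) N%:R^-1 * (u x * del i x) =
        u x * (N%:R^-1 * \sum_(i < N) del i x).
      by rewrite !mulr_sumr; apply: eq_bigr => i _; ring.
    by rewrite ler_wpM2l// sum_del ler_piMr.
Qed.

End plan.

(** * Conservation of mass in a plan *)

Section plan_theory.
Context d (T : measurableType d) (R : realType) (mu : probability T R)
  (K : countType) (y : nat -> T) (N : nat) (N0 : (0 < N)%N).

Let Nneq0 : (N%:R : R) != 0.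
Proof. by rewrite pnatr_eq0 -lt0n. Qed.

Let Ninv : 0 <= (N%:R : R)^-1.
Proof. by rewrite invr_ge0. Qed.

Lemma plan_trivial (kap : T -> K) :
  plan mu y N kap (fun=> 1) (fun=> 1) (fun _ _ => 0).
Proof.
split => //.
- by move=> x; rewrite big1 // mulr0 add0r.
- by move=> i; rewrite integral0 add0e.
- by move=> i x; rewrite eqxx.
Qed.

Lemma plan_cost_trivial c : plan_cost mu N c (fun _ _ => 0) = 0%E.
Proof.
apply: big1 => i _; rewrite (eq_integral (cst 0%E)) ?integral0 ?mule0//.
by move=> x _; rewrite mulr0.
Qed.

Lemma plan_mass (kap : T -> K) f g h A : plan mu y N kap f g h -> measurable A ->
  (mu A = \sum_(i < N) (N%:R^-1)%:E * (\int[mu]_(x in A) (h i x)%:E) +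
     \int[mu]_(x in A) (f x)%:E)%E.
Proof.
move=> [mf f0 g0 mh h0 row col loc] mA.
have -> : mu A = (\int[mu]_(x in A)
    (\sum_(i < N) (N%:R^-1 * h i x)%:E + (f x)%:E))%E.
  rewrite -[LHS]mul1e -integral_cst//; apply: eq_integral => x _ /=.
  by rewrite sumEFin -EFinD -mulr_sumr row.
rewrite ge0_integralD//; last 4 first.
- by move=> x _; apply: sume_ge0 => i _; rewrite lee_fin mulr_ge0.
- apply: emeasurable_sum => i; apply/measurable_EFinP; apply: measurable_funM => //.
  exact: measurable_funTS.
- by move=> x _; rewrite lee_fin.
- by apply/measurable_EFinP; exact: measurable_funTS.
rewrite ge0_integral_sum//; last 2 first.
- move=> i; apply/measurable_EFinP; apply: measurable_funM => //.
  exact: measurable_funTS.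
- by move=> i x _; rewrite lee_fin mulr_ge0.
congr (_ + _)%E; apply: eq_bigr => i _; under eq_integral do rewrite EFinM.
rewrite ge0_integralZl ?lee_fin//.
- by apply/measurable_EFinP; exact: measurable_funTS.
- by move=> x _; rewrite lee_fin.
Qed.

(** Conservation of mass: by [plan_loc] every match stays within a cell, so both sides of the cell
    lose equal amounts. The additive form avoids subtraction in the extended reals. *)
Lemma plan_cell (kap : T -> K) f g h k : plan mu y N kap f g h ->
  (forall k, measurable (kap @^-1` [set k])) ->
  (mu (kap @^-1` [set k]) + (N%:R^-1 * \sum_(i < N | kap (y i) == k) g i)%:E =
   \int[mu]_(x in kap @^-1` [set k]) (f x)%:E +
     (N%:R^-1 * \sum_(i < N | kap (y i) == k) 1)%:E)%E.
Proof.
move=> Pl mk; rewrite (plan_mass Pl (mk k)) addeAC addeC; congr (_ + _)%E.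
have [mf f0 g0 mh h0 row col loc] := Pl.
rewrite !mulr_sumr -!sumEFin !(big_mkcond (fun i : 'I_N => kap (y i) == k)) /=.
rewrite -big_split /=; apply: eq_bigr => i _.
have [kik|kik] := eqVneq (kap (y i)) k.
  have -> : (\int[mu]_(x in kap @^-1` [set k]) (h i x)%:E =
      \int[mu]_x (h i x)%:E)%E.
    rewrite integral_cell; apply: eq_integral => x _.
    have [->|/loc ->] := eqVneq (h i x) 0; first by rewrite mul0r.
    by rewrite kik eqxx mulr1.
  rewrite !EFinM -(col i) [in RHS]ge0_muleDr ?lee_fin//.
  by apply: integral_ge0 => x _; rewrite lee_fin.
rewrite adde0 integral_cell (eq_integral (cst 0%E)) ?integral0 ?mule0// => x _.
have [->|/loc ->] := eqVneq (h i x) 0; first by rewrite mul0r.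
by rewrite (negbTE kik) mulr0.
Qed.

(** By [plan_cell] the two remainders differ by the difference of the two masses of the cell; one of
    them is zero, so their sum is its absolute value. From here on the estimates no longer depend on
    how the mass was matched. *)
Lemma balanced_cell (kap : T -> K) f g h k : plan mu y N kap f g h ->
  (forall k, measurable (kap @^-1` [set k])) -> balanced mu y N kap f g ->
  (\int[mu]_(x in kap @^-1` [set k]) (f x)%:E +
     (N%:R^-1 * \sum_(i < N | kap (y i) == k) g i)%:E =
   `| mu (kap @^-1` [set k]) -
      (N%:R^-1 * \sum_(i < N | kap (y i) == k) 1)%:E |)%E.
Proof.
move=> Pl mk bal; have := plan_cell k Pl mk.
have muf : mu (kap @^-1` [set k]) \is a fin_num by exact: fin_num_measure.
have nu0 : 0 <= N%:R^-1 * \sum_(i < N | kap (y i) == k) g i.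
  by rewrite mulr_ge0 // sumr_ge0// => i _; exact: (plan_g0 Pl).
case: (bal k) => [->|gi0].
  move: (mu _) muf => [m| |] // _ /(congr1 fine) /=; rewrite add0r add0e => <-.
  by rewrite /= opprD addNKr normrN ger0_norm.
rewrite big1 ?mulr0 ?adde0; last by move=> i /eqP; apply: gi0.
move=> ->; rewrite addeK ?gee0_abs//.
by apply: integral_ge0 => x _; rewrite lee_fin (plan_f0 Pl).
Qed.

(** With a single cell both sides have total mass 1, so the deviation in [balanced_cell] is zero and
    both remainders vanish. *)
Lemma plan_complete (kap : T -> K) f g h : plan mu y N kap f g h ->
  (forall x x', kap x = kap x') -> balanced mu y N kap f g ->
  (\int[mu]_x (f x)%:E = 0)%E /\ forall i, (i < N)%N -> g i = 0.
Proof.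
move=> Pl cst_kap bal.
have cellT : kap @^-1` [set kap (y 0%N)] = setT.
  by apply/seteqP; split => // x _; rewrite /preimage /=; exact: cst_kap.
have mk k : measurable (kap @^-1` [set k]).
  have [->|ky] := eqVneq k (kap (y 0%N)); first by rewrite cellT.
  rewrite (_ : _ @^-1` _ = set0)//; apply/seteqP; split => // x /= kx.
  by move: ky; rewrite -kx (cst_kap x (y 0%N)) eqxx.
have f0 : (0 <= \int[mu]_x (f x)%:E)%E.
  by apply: integral_ge0 => x _; rewrite lee_fin (plan_f0 Pl).
have := balanced_cell (kap (y 0%N)) Pl mk bal.
have alli (F : nat -> R) : \sum_(i < N | kap (y i) == kap (y 0%N)) F i = \sum_(i < N) F i.
  by apply: eq_bigl => i; rewrite (cst_kap (y i) (y 0%N)) eqxx.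
rewrite cellT probability_setT (alli (fun=> 1)) alli.
rewrite big_const_ord iter_addr_0 mulVf// subee// abse0 => /eqP.
rewrite padde_eq0//; last first.
  by rewrite lee_fin mulr_ge0 // sumr_ge0// => i _; exact: (plan_g0 Pl).
case/andP => /eqP -> /eqP [] /eqP; rewrite mulf_eq0 invr_eq0 (negbTE Nneq0) /=.
rewrite psumr_eq0 => [/allP gi|i _]; last exact: (plan_g0 Pl).
split=> // i iN; apply/eqP; exact: (gi (Ordinal iN) (mem_index_enum _)).
Qed.

End plan_theory.

(** * From plans to couplings *)

Section coupling_of_plan.
Context d (T : measurableType d) (R : realType) (mu : probability T R)
  (y : nat -> T) (N : nat) (h : nat -> T -> R)
  (h0 : forall i x, 0 <= h i x) (mh : forall i, measurable_fun setT (h i)).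

Definition slice_measure (i : nat) : {measure set (T * T) -> \bar R}.
Proof.
refine (pushforward (with_density mu (h0 i) (mh i)) (pair^~ (y i))
  : {measure set (T * T) -> \bar R}).
exact: pair2_measurable.
Defined.

Definition plan_measure : set (T * T) -> \bar R :=
  msum (fun i => mscale (N%:R^-1)%:nng (slice_measure i)) N.

HB.instance Definition _ := Measure.on plan_measure.

Lemma plan_measureE A : measurable A -> plan_measure A =
  (\sum_(i < N) (N%:R^-1)%:E * \int[mu]_(x in pair^~ (y i) @^-1` A) (h i x)%:E)%E.
Proof. by []. Qed.

Lemma ge0_integral_plan_measure (c : T * T -> R) :
  measurable_fun setT c -> (forall z, 0 <= c z) ->
  (\int[plan_measure]_z (c z)%:E = plan_cost mu N (fun i x => c (x, y i)) h)%E.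
Proof.
move=> mc c0.
have mcE : measurable_fun setT (EFin \o c) by exact/measurable_EFinP.
rewrite /plan_cost (ge0_integral_measure_sum _ measurableT)//; last first.
  by move=> z _; rewrite lee_fin.
apply: eq_bigr => i _; rewrite ge0_integral_mscale//; last first.
  by move=> z _; rewrite lee_fin.
congr (_ * _)%E.
rewrite (@ge0_integral_pushforward _ _ _ _ _ (pair^~ (y i)))//; last first.
  by move=> z _; rewrite /= lee_fin.
rewrite preimage_setT ge0_integral_with_density//=.
- by move=> x; rewrite lee_fin.
- by apply: measurableT_comp => //; exact: pair2_measurable.
Qed.

End coupling_of_plan.

(** Once nothing is left over, the row identity of the plan gives the first marginal and the column
    identity the second. *)
Lemma coupling_of_plan d (T : measurableType d) (R : realType)
    (mu : probability T R) (K : countType) (y : nat -> T) (N : nat)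
    (kap : T -> K) f g h : (0 < N)%N -> plan mu y N kap f g h ->
  (forall x x', kap x = kap x') -> balanced mu y N kap f g ->
  exists pi : probability (T * T)%type R, [/\
    forall A, measurable A -> pushforward pi fst A = mu A,
    forall A, measurable A -> pushforward pi snd A =
      (\sum_(i < N) (N%:R^-1)%:E * \d_(y i) A)%E &
    forall c : T * T -> R, measurable_fun setT c -> (forall z, 0 <= c z) ->
      (\int[pi]_z (c z)%:E = plan_cost mu N (fun i x => c (x, y i)) h)%E].
Proof.
move=> N0 Pl kapc bal.
have [intf gi0] := plan_complete N0 Pl kapc bal.
have [mf f0 g0 mh h0 row col loc] := Pl.
pose pi := plan_measure mu y N h0 mh.
have inth i : (i < N)%N -> (\int[mu]_x (h i x)%:E = 1)%E.
  by move=> iN; rewrite -(col i) gi0// adde0.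
have int0 A : measurable A -> (\int[mu]_(x in A) (f x)%:E = 0)%E.
  move=> mA; apply/eqP; rewrite eq_le; apply/andP; split; last first.
    by apply: integral_ge0 => x _; rewrite lee_fin.
  rewrite -intf; apply: ge0_subset_integral => //.
  - exact/measurable_EFinP.
  - by move=> x _; rewrite lee_fin.
have fstE A : measurable A -> pushforward pi fst A = mu A.
  move=> mA; rewrite /pushforward /pi plan_measureE; last first.
    by rewrite -[X in measurable X]setTI; exact: measurable_fst.
  by rewrite (plan_mass Pl mA) int0// adde0.
have sndE A : measurable A -> pushforward pi snd A =
   (\sum_(i < N) (N%:R^-1)%:E * \d_(y i) A)%E.
  move=> mA; rewrite /pushforward /pi plan_measureE; last first.
    by rewrite -[X in measurable X]setTI; exact: measurable_snd.
  apply: eq_bigr => i _; congr (_ * _)%E; rewrite diracE.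
  have [yA|yA] := boolP (y i \in A).
    rewrite -(inth i)//; congr (integral _ _ _); apply/seteqP; split=> // x _ /=.
    exact: set_mem.
  rewrite (_ : (_ @^-1` _) = set0) ?integral_set0//.
  by apply/seteqP; split => // x /= /mem_set; rewrite (negbTE yA).
have piT : pi setT = 1%E.
  by have := fstE setT measurableT; rewrite probability_setT.
pose piP : probability (T * T)%type R := HB.pack pi
  (Measure_isProbability.Build _ _ _ pi piT).
by exists piP; split => // c mc c0; exact: ge0_integral_plan_measure.
Qed.

(** Iterates [plan_step] from level [L] down to level 0, then once more with the whole space as the
    only cell, named [k0]. The first step starts with nothing matched and costs the term with [e L];
    the step at level [l < L] acts on what level [l.+1] left, hence [Dv l.+1]; the final step acts
    on what level 0 left and uses the crude bound [w x + w x']. *)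
Lemma multilevel_coupling d (T : measurableType d) (R : realType)
    (mu : probability T R) (K : countType) (y : nat -> T) (N L : nat)
    (c : T * T -> R) (kap : nat -> T -> K) (k0 : K) (w : T -> R) (e : nat -> R)
    (Dv : nat -> \bar R) :
  (0 < N)%N -> measurable_fun setT c -> (forall z, 0 <= c z) ->
  (forall l k, measurable (kap l @^-1` [set k])) ->
  (forall l x x', kap l.+1 x = kap l.+1 x' -> kap l x = kap l x') ->
  measurable_fun setT w -> (forall x, 0 <= w x) -> (forall l, 0 <= e l) ->
  (forall l x x', kap l x = kap l x' -> c (x, x') <= e l * (w x + w x')) ->
  (forall x x', c (x, x') <= w x + w x') ->
  (forall l f g h, plan mu y N (kap l) f g h -> balanced mu y N (kap l) f g ->
    (\int[mu]_x (w x * f x)%:E + (N%:R^-1 * \sum_(i < N) w (y i) * g i)%:E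
       <= Dv l)%E) ->
  exists pi : probability (T * T)%type R, [/\
    forall A, measurable A -> pushforward pi fst A = mu A,
    forall A, measurable A -> pushforward pi snd A =
      (\sum_(i < N) (N%:R^-1)%:E * \d_(y i) A)%E &
    (\int[pi]_z (c z)%:E <=
      (e L)%:E * (\int[mu]_x (w x)%:E + (N%:R^-1 * \sum_(i < N) w (y i))%:E) +
      \sum_(0 <= l < L) (e l)%:E * Dv l.+1 + Dv 0%N)%E].
Proof.
move=> N0 mc c0 mk nest mw w0 e0 ce cw hD.
pose cc i x := c (x, y i).
have mcc i : measurable_fun setT (cc i).
  by apply: measurableT_comp => //; exact: pair2_measurable.
have cc0 i x : 0 <= cc i x by exact: c0.
pose W0 := ((e L)%:E * (\int[mu]_x (w x)%:E + (N%:R^-1 * \sum_(i < N) w (y i))%:E))%E.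
have scale (r : R) (f : T -> R) (g : nat -> R) : 0 <= r ->
   measurable_fun setT f -> (forall x, 0 <= f x) ->
   (forall i, 0 <= g i) ->
   (\int[mu]_x (r * w x * f x)%:E +
      (N%:R^-1 * \sum_(i < N) r * w (y i) * g i)%:E =
    r%:E * (\int[mu]_x (w x * f x)%:E +
      (N%:R^-1 * \sum_(i < N) w (y i) * g i)%:E))%E.
  move=> r0 mf f0 g0; rewrite ge0_muleDr//; last 2 first.
  - by apply: integral_ge0 => x _; rewrite lee_fin mulr_ge0.
  - by rewrite lee_fin mulr_ge0 ?invr_ge0 // sumr_ge0 // => i _; rewrite mulr_ge0.
  congr (_ + _)%E.
    under eq_integral do rewrite -mulrA EFinM.
    rewrite ge0_integralZl ?lee_fin//.
    - by apply/measurable_EFinP; exact: measurable_funM.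
    - by move=> x _; rewrite lee_fin mulr_ge0.
  rewrite -EFinM mulrCA; congr (_ * _)%:E; rewrite mulr_sumr.
  by apply: eq_bigr => i _; rewrite mulrA.
have step l f g h (kap' : T -> K) : plan mu y N kap' f g h ->
    (forall x x', kap' x = kap' x' -> kap l x = kap l x') ->
    exists f' g' h', [/\ plan mu y N (kap l) f' g' h',
      balanced mu y N (kap l) f' g' &
      (plan_cost mu N cc h' <= plan_cost mu N cc h +
       (e l)%:E * (\int[mu]_x (w x * f x)%:E +
      (N%:R^-1 * \sum_(i < N) w (y i) * g i)%:E))%E].
  move=> Pl hn.
  rewrite -(scale _ _ _ (e0 l) (plan_mf Pl) (plan_f0 Pl) (plan_g0 Pl)).
  apply: (plan_step N0 Pl) => //.
  - exact: measurable_funM.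
  - by move=> x; rewrite mulr_ge0.
  - by move=> i x /ce; rewrite mulrDr.
(* Induction on the number [j] of levels finer than [l] that have already been treated. *)
have main j l : (l + j)%N = L -> exists f g h, [/\ plan mu y N (kap l) f g h,
    balanced mu y N (kap l) f g &
    (plan_cost mu N cc h <= W0 + \sum_(l <= i < L) (e i)%:E * Dv i.+1)%E].
  elim: j l => [|j IH] l.
    rewrite addn0 => ->.
    have [f [g [h [P1 P2 P3]]]] :=
      step L _ _ _ _ (plan_trivial mu y N (kap L)) (fun _ _ => id).
    exists f, g, h; split => //; rewrite big_geq// adde0 (le_trans P3)//.
    rewrite plan_cost_trivial add0e /W0 /= le_eqVlt; apply/orP; left; apply/eqP.
    congr (_ * (_ + _))%E; first by apply: eq_integral => x _; rewrite mulr1.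
    by under eq_bigr do rewrite mulr1.
  rewrite addnS -addSn => lj; have [f [g [h [Pf Bf Cf]]]] := IH _ lj.
  have [f' [g' [h' [Pf' Bf' Cf']]]] := step l _ _ _ _ Pf (nest l).
  exists f', g', h'; split => //; apply: (le_trans Cf').
  rewrite (@big_ltn _ _ _ l); last by rewrite -lj addSn ltnS leq_addr.
  rewrite [in X in (_ <= X)%E]addeCA [X in (X <= _)%E]addeC; apply: leeD => //.
  by rewrite lee_wpmul2l ?lee_fin//; exact: hD Pf Bf.
have [f [g [h [Pf Bf Cf]]]] := main L 0%N erefl.
have mk0 k : measurable ((fun=> k0) @^-1` [set k] : set T).
  by rewrite preimage_cst; case: ifPn.
have [f' [g' [h' [Pf' Bf' Cf']]]] := plan_step (kap' := fun=> k0) N0 Pf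
  mk0 (fun _ _ _ => erefl) mcc cc0 mw w0
  (fun i x _ => cw x (y i)).
have [pi [pi1 pi2 pi3]] := coupling_of_plan N0 Pf' (fun _ _ => erefl) Bf'.
exists pi; split => //; rewrite pi3// (le_trans Cf')// leeD//; exact: hD Pf Bf.
Qed.

Lemma nneseries_ge_term (R : realType) (u : nat -> \bar R) m :
  (forall n, (0 <= u n)%E) -> (u m <= \sum_(n <oo) u n)%E.
Proof.
move=> u0; apply: (@le_trans _ _ (\sum_(0 <= n < m.+1) u n)%E).
  by rewrite big_nat_recr//= leeDr// sume_ge0.
by apply: nneseries_lim_ge => n _ _.
Qed.

(** * Remainders bounded by deviations on cells *)

Section cell_deviation.
Context d (T : measurableType d) (R : realType) (mu : probability T R)
  (K : countType) (I : finType) (y : nat -> T) (N : nat).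

Definition deviation (A : set T) : \bar R :=
  (`| mu A - (N%:R^-1 * \sum_(i < N) \1_A (y i))%:E |)%E.

(** The weight of a point is at most the sum of [W n] over all pairs [(n, F)] whose cell contains
    it. Exchanging sums and integral leaves, in each cell, the total remainder, which
    [balanced_cell] identifies. An inequality is enough, so the labels [lab n F] only have to
    exhaust the cells. *)
Lemma balanced_weight (kap : T -> K) (ann : K -> nat) (lab : nat -> I -> K)
    (W : nat -> R) f g h :
  (forall n, 0 <= W n) ->
  (forall k, measurable (kap @^-1` [set k])) ->
  (forall x, exists F, kap x = lab (ann (kap x)) F) ->
  plan mu y N kap f g h -> balanced mu y N kap f g ->
  (\int[mu]_x (W (ann (kap x)) * f x)%:E +
     (N%:R^-1 * \sum_(i < N) W (ann (kap (y i))) * g i)%:E <=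
   \sum_(n <oo) (W n)%:E * \sum_(F : I) deviation (kap @^-1` [set lab n F]))%E.
Proof.
move=> W0 mk hlab Pl Bl; have [mf f0 g0 mh h0 row col loc] := Pl.
pose t n F x := W n * (kap x == lab n F)%:R.
have t0 n F x : 0 <= t n F x by rewrite mulr_ge0.
have mt n F : measurable_fun setT (t n F).
  by apply: measurable_funM => //; exact: measurable_eq_label.
have Wle x r : 0 <= r ->
  ((W (ann (kap x)) * r)%:E <= \sum_(n <oo) \sum_(F : I) (t n F x * r)%:E)%E.
  move=> r0; have [F kF] := hlab x.
  apply: le_trans (@nneseries_ge_term _ _ (ann (kap x)) _) => [|n]; last first.
    by apply: sume_ge0 => G _; rewrite lee_fin mulr_ge0.
  have tF : t (ann (kap x)) F x = W (ann (kap x)) by rewrite /t -kF eqxx mulr1.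
  rewrite (bigD1 F)//= tF leeDl// sume_ge0// => G _.
  by rewrite lee_fin mulr_ge0.
have -> : (\sum_(n <oo) (W n)%:E * \sum_(F : I) deviation (kap @^-1` [set lab n F]) =
  \sum_(n <oo) (\sum_(F : I) \int[mu]_x (t n F x * f x)%:E +
     (N%:R^-1 * \sum_(i < N) \sum_(F : I) t n F (y i) * g i)%:E))%E.
  apply: eq_eseriesr => n _.
  rewrite exchange_big mulr_sumr -sumEFin -big_split /= ge0_sume_distrr; last first.
    by move=> F _; rewrite /deviation.
  apply: eq_bigr => F _.
  have -> : deviation (kap @^-1` [set lab n F]) =
     (\int[mu]_(x in kap @^-1` [set lab n F]) (f x)%:E +
      (N%:R^-1 * \sum_(i < N | kap (y i) == lab n F) g i)%:E)%E.
    rewrite (balanced_cell _ Pl)// /deviation; congr (`| _ - (_ * _)%:E |)%E.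
    rewrite [RHS]big_mkcond /=; apply: eq_bigr => i _; rewrite indicE.
    have -> : (y i \in kap @^-1` [set lab n F]) = (kap (y i) == lab n F).
      by apply/idP/eqP; rewrite inE.
    by case: eqP.
  rewrite ge0_muleDr; last 2 first.
  - by apply: integral_ge0 => x _; rewrite lee_fin.
  - by rewrite lee_fin mulr_ge0 ?invr_ge0// sumr_ge0.
  congr (_ + _)%E.
    rewrite integral_cell -ge0_integralZl ?lee_fin//.
    - by apply: eq_integral => x _; rewrite -EFinM /t; congr _%:E; ring.
    - by apply/measurable_EFinP; apply: measurable_funM => //; exact: measurable_eq_label.
    - by move=> x _; rewrite lee_fin mulr_ge0.
  rewrite -EFinM mulrCA; congr (_ * _)%:E; rewrite mulr_sumr big_mkcond /=.
  by apply: eq_bigr => i _; rewrite /t; case: eqP => _; rewrite ?(mulr1, mulr0, mul0r).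
rewrite nneseriesD; last 2 first.
- move=> n _ _; apply: sume_ge0 => F _; apply: integral_ge0 => x _.
  by rewrite lee_fin mulr_ge0.
- move=> n _ _; rewrite lee_fin mulr_ge0 ?invr_ge0// sumr_ge0// => i _.
  by rewrite sumr_ge0// => F _; rewrite mulr_ge0.
apply: leeD.
  have mtf n F : measurable_fun setT (fun x => (t n F x * f x)%:E).
    by apply/measurable_EFinP; exact: measurable_funM.
  under eq_eseriesr => n _.
    rewrite -(@ge0_integral_sum _ _ _ mu setT measurableT _
      (fun F x => (t n F x * f x)%:E))//; last first.
      by move=> F x _; rewrite lee_fin mulr_ge0.
    over.
  rewrite -integral_nneseries//; last 2 first.
  - by move=> n; apply: emeasurable_sum.
  - by move=> n x _; apply: sume_ge0 => F _; rewrite lee_fin mulr_ge0.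
  apply: ge0_le_integral => //.
  - by move=> x _; rewrite lee_fin mulr_ge0.
  - apply/measurable_EFinP; apply: measurable_funM => //.
    exact: (measurable_label (fun k => W (ann k)) mk).
  - apply: ge0_emeasurable_sum => [n x _ _|n _].
      by apply: sume_ge0 => F _; rewrite lee_fin mulr_ge0.
    exact: emeasurable_sum.
  - by move=> x _; exact: Wle.
have tg0 n i : (0 <= \sum_(F : I) (t n F (y i) * g i)%:E)%E.
  by apply: sume_ge0 => F _; rewrite lee_fin mulr_ge0.
under eq_eseriesr => n _.
  rewrite mulr_sumr -sumEFin; under eq_bigr do rewrite EFinM -sumEFin; over.
rewrite mulr_sumr -sumEFin nneseries_sum; last first.
  by move=> i n _; rewrite mule_ge0 ?lee_fin ?invr_ge0.
apply: lee_sum => i _; rewrite nneseriesZl//; last first.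
by rewrite EFinM lee_wpmul2l ?lee_fin ?invr_ge0// Wle.
Qed.

End cell_deviation.

(** * Deviation of the empirical measure *)

Section empirical_deviation.
Context (R : realType) (dO dT : measure_display) (O : measurableType dO)
  (T : measurableType dT) (P : probability O R) (X : nat -> {RV P >-> T})
  (mu : probability T R) (iid : iid_with_law X mu) (N : nat) (N0 : (0 < N)%N).

Let Ninv : 0 <= (N%:R : R)^-1.
Proof. by rewrite invr_ge0. Qed.

Let Nneq0 : (N%:R : R) != 0.
Proof. by rewrite pnatr_eq0 -lt0n. Qed.

Lemma measurable_RV_indic (A : set T) i : measurable A ->
  measurable_fun setT (fun w => \1_A (X i w) : R).
Proof.
move=> mA; apply: (@measurableT_comp _ _ _ _ _ _ (\1_A : T -> R)) => //.
Qed.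

Lemma integral_RV_indic (A : set T) i : measurable A ->
  (\int[P]_w (\1_A (X i w) : R)%:E = mu A)%E.
Proof.
move=> mA; rewrite -(iid.2 i A mA) /distribution /pushforward.
rewrite -[X in P X]setIT -integral_indic//.
by rewrite -[X in measurable X]setTI; exact: measurable_funPT.
Qed.

Lemma integral_RV_indic2 (A : set T) i j : measurable A -> i != j ->
  (\int[P]_w (\1_A (X i w) * \1_A (X j w) : R)%:E = mu A * mu A)%E.
Proof.
move=> mA ij.
have := iid.1 [fset i; j]%fset (fun=> A) (fun=> mA).
have mXA k : measurable (X k @^-1` A).
  by rewrite -[X in measurable X]setTI; exact: measurable_funPT.
rewrite big_fsetU1 ?inE//= big_seq_fset1.
have PX k : P (X k @^-1` A) = mu A by exact: (iid.2 k A mA).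
rewrite !PX => <-.
have -> : \bigcap_(k in [set` [fset i; j]%fset]) (X k @^-1` A) =
    X i @^-1` A `&` X j @^-1` A.
  apply/seteqP; split => [w h|w [h1 h2] k].
    by split; apply: h; rewrite /= !inE eqxx ?orbT.
  by rewrite /= !inE => /orP[/eqP ->|/eqP ->].
rewrite -[X in P X]setIT -integral_indic//; last exact: measurableI.
by apply: eq_integral => w _; rewrite indicI.
Qed.

Let S (A : set T) (w : O) : R := N%:R^-1 * \sum_(i < N) \1_A (X i w).

Let S0 A w : 0 <= S A w.
Proof. by rewrite mulr_ge0 // sumr_ge0. Qed.

Let mS A : measurable A -> measurable_fun setT (S A).
Proof.
move=> mA; apply: measurable_funM => //; apply: measurable_sum => i.
exact: measurable_RV_indic.
Qed.

Let integral_S A : measurable A -> (\int[P]_w (S A w)%:E = mu A)%E.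
Proof.
move=> mA; under eq_integral do rewrite /S mulr_sumr -sumEFin.
rewrite ge0_integral_sum//; last first.
  move=> i; apply/measurable_EFinP; apply: measurable_funM => //.
  exact: measurable_RV_indic.
under eq_bigr => i _.
  under eq_integral do rewrite EFinM.
  rewrite ge0_integralZl ?lee_fin//; last first.
    by apply/measurable_EFinP; exact: measurable_RV_indic.
  rewrite integral_RV_indic//; over.
rewrite -(fineK (fin_num_measure mu A mA)) -EFinM sumEFin; congr _%:E.
by rewrite sumr_const card_ord -mulr_natr; field; rewrite Nneq0.
Qed.

(** In the expanded square each of the [N] diagonal terms has mean [q], and by independence every
    other term has mean [q ^+ 2]. *)
Let integral_SS A : measurable A -> (\int[P]_w (S A w ^+ 2)%:E =
  (N%:R^-1 * (fine (mu A)) + (1 - N%:R^-1) * fine (mu A) ^+ 2)%:E)%E.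
Proof.
move=> mA; set q := fine (mu A).
have muq : mu A = q%:E by rewrite fineK// fin_num_measure.
have SE w : (S A w ^+ 2)%:E = (\sum_(i < N) \sum_(j < N)
     (N%:R^-1 ^+ 2)%:E * (\1_A (X i w) * \1_A (X j w) : R)%:E)%E.
  under eq_bigr do (under eq_bigr do rewrite -EFinM; rewrite sumEFin).
  rewrite sumEFin; congr _%:E; rewrite /S exprMn [X in _ * X]expr2 mulr_suml mulr_sumr.
  by apply: eq_bigr => i _; rewrite -mulr_sumr; congr (_ * _); rewrite mulr_sumr.
under eq_integral do rewrite SE.
have mI i j : measurable_fun setT (fun w => (\1_A (X i w) * \1_A (X j w) : R)%:E).
  by apply/measurable_EFinP; apply: measurable_funM; exact: measurable_RV_indic.
have I0 i j w : (0 <= (\1_A (X i w) * \1_A (X j w) : R)%:E)%E.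
  by rewrite lee_fin mulr_ge0.
have n2 : (0 <= ((N%:R : R)^-1 ^+ 2)%:E)%E by rewrite lee_fin exprn_ge0.
rewrite ge0_integral_sum//; last 2 first.
- move=> i; apply: emeasurable_sum => j; apply: measurable_funeM; exact: mI.
- by move=> i w _; apply: sume_ge0 => j _; rewrite mule_ge0.
under eq_bigr => i _.
  rewrite ge0_integral_sum//; last first.
    by move=> j; apply: measurable_funeM; exact: mI.
  rewrite (eq_bigr (fun j : 'I_N =>
      ((N%:R^-1 ^+ 2) * (q ^+ 2 + (i == j)%:R * (q - q ^+ 2)))%:E)); last first.
    move=> j _; rewrite ge0_integralZl//.
    have [<-|ij] := eqVneq i j.
      rewrite (eq_integral (fun w => (\1_A (X i w) : R)%:E)).
        by rewrite integral_RV_indic// muq -EFinM mul1r addrC subrK.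
      by move=> w _; rewrite indicE; case: (_ \in _); rewrite ?mulr1 ?mulr0.
    by rewrite integral_RV_indic2// muq -!EFinM mul0r addr0 expr2.
  rewrite sumEFin -mulr_sumr big_split /= sumr_const card_ord -mulr_suml.
  rewrite (bigD1 i)//= eqxx big1 ?addr0; last by move=> j /negbTE; rewrite eq_sym => ->.
  over.
rewrite sumEFin sumr_const card_ord /= mul1r; congr _%:E.
by rewrite -[LHS]mulr_natr -(mulr_natr (q ^+ 2)); field.
Qed.

(** The variance of the empirical mass is [q * (1 - q) / N]. *)
Let mean_square A : measurable A ->
  (\int[P]_w ((fine (mu A) - S A w) ^+ 2)%:E <= (fine (mu A) / N%:R)%:E)%E.
Proof.
move=> mA; set q := fine (mu A).
have muq : mu A = q%:E by rewrite fineK// fin_num_measure.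
have q0 : 0 <= q by rewrite fine_ge0.
have msq : measurable_fun setT (fun w => (q - S A w) ^+ 2).
  by apply: measurable_funX; apply: measurable_funB => //; exact: mS.
have mSE : measurable_fun setT (fun w => (S A w)%:E).
  by apply/measurable_EFinP; exact: mS.
(* The cross term is moved to the other side, so that only integrals of nonnegative functions are
   added. *)
have H : (\int[P]_w ((q - S A w) ^+ 2)%:E + (2 * q * q)%:E =
    (q ^+ 2 + (N%:R^-1 * q + (1 - N%:R^-1) * q ^+ 2))%:E)%E.
  have q2 : ((q ^+ 2)%:E = \int[P]_w (q ^+ 2)%:E)%E.
    by rewrite integral_cst//= probability_setT mule1.
  rewrite [RHS]EFinD -(integral_SS mA) q2.
  have -> : ((2 * q * q)%:E = \int[P]_w ((2 * q)%:E * (S A w)%:E))%E.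
    rewrite ge0_integralZl//; last 2 first.
    - by move=> w _; rewrite lee_fin.
    - by rewrite lee_fin mulr_ge0.
    by rewrite integral_S// muq -EFinM.
  have qS0 w : setT w -> (0 <= (2 * q)%:E * (S A w)%:E)%E.
    by move=> _; apply: mule_ge0; rewrite lee_fin; [exact: mulr_ge0|exact: S0].
  rewrite -!ge0_integralD//; try (by move=> w _; rewrite lee_fin sqr_ge0);
    try exact: measurable_funeM;
    try (by apply/measurable_EFinP; apply: measurable_funX; exact: mS);
    try exact/measurable_EFinP.
  by apply: eq_integral => w _; rewrite -EFinM -!EFinD; congr _%:E; ring.
have I0 : (0 <= \int[P]_w ((q - S A w) ^+ 2)%:E)%E.
  by apply: integral_ge0 => w _; rewrite lee_fin sqr_ge0.
move: (integral _ _ _) H I0 => [r| |] //=; rewrite -EFinD => -[H] _.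
have -> : r = N%:R^-1 * q - N%:R^-1 * q ^+ 2.
  by apply: (addIr (2 * q * q)); rewrite H; ring.
by rewrite lee_fin mulrC gerBl mulr_ge0// sqr_ge0.
Qed.

Lemma deviation_real A w : measurable A ->
  deviation mu (fun i => X i w) N A = `|fine (mu A) - S A w|%:E.
Proof.
by move=> mA; rewrite /deviation -(fineK (fin_num_measure mu A mA)) -EFinB.
Qed.

Lemma measurable_deviation A : measurable A ->
  measurable_fun setT (fun w => deviation mu (fun i => X i w) N A).
Proof.
move=> mA; under eq_fun do rewrite deviation_real//.
apply/measurable_EFinP; apply: measurableT_comp => //.
by apply: measurable_funB => //; exact: mS.
Qed.

Lemma deviation_le2 A : measurable A ->
  (\int[P]_w deviation mu (fun i => X i w) N A <= 2%:E * mu A)%E.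
Proof.
move=> mA; have muq : mu A = (fine (mu A))%:E by rewrite fineK// fin_num_measure.
apply: (@le_trans _ _ (\int[P]_w (mu A + (S A w)%:E))%E).
  apply: ge0_le_integral => //.
  - by move=> w _; rewrite /deviation.
  - exact: measurable_deviation.
  - by apply: emeasurable_funD => //; apply/measurable_EFinP; exact: mS.
  - move=> w _; rewrite deviation_real// muq -EFinD lee_fin.
    by rewrite (le_trans (ler_normB _ _))//= !ger0_norm ?S0 ?fine_ge0.
rewrite ge0_integralD//; last 2 first.
- by move=> w _; rewrite lee_fin.
- by apply/measurable_EFinP; exact: mS.
rewrite integral_cst//= probability_setT mule1 integral_S//.
by rewrite muq -EFinD -EFinM lee_fin mulr_natl mulr2n.
Qed.

(* AM-GM with a parameter [s] common to all cells makes the sum over the cells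
   of a partition available without Cauchy-Schwarz. *)
Lemma deviation_le_AMGM A (s : R) : measurable A -> 0 < s ->
  (\int[P]_w deviation mu (fun i => X i w) N A <=
     ((fine (mu A) / N%:R) / (2 * s) + s / 2)%:E)%E.
Proof.
move=> mA s0; set q := fine (mu A).
have s20 : 0 <= (2 * s)^-1 by rewrite invr_ge0 mulr_ge0// ltW.
have msq : measurable_fun setT (fun w => ((q - S A w) ^+ 2)%:E).
  apply/measurable_EFinP; apply: measurable_funX.
  by apply: measurable_funB => //; exact: mS.
apply: (@le_trans _ _ (\int[P]_w ((2 * s)^-1%:E * ((q - S A w) ^+ 2)%:E + (s / 2)%:E))%E).
  apply: ge0_le_integral => //.
  - by move=> w _; rewrite /deviation.
  - exact: measurable_deviation.
  - by apply: emeasurable_funD => //; exact: measurable_funeM.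
  - move=> w _; rewrite deviation_real// -EFinM -EFinD lee_fin -/q.
    rewrite -(real_normK (num_real (q - S A w))); move: (`|_|) => z.
    rewrite -subr_ge0 (_ : _ - _ = (2 * s)^-1 * (z - s) ^+ 2).
      by rewrite mulr_ge0// sqr_ge0.
    by field; rewrite gt_eqF.
have sq0 w : setT w -> (0 <= ((2 * s)^-1)%:E * ((q - S A w) ^+ 2)%:E)%E.
  by move=> _; apply: mule_ge0; rewrite lee_fin// sqr_ge0.
have cst0 w : setT w -> (0 <= (s / 2)%:E :> \bar R)%E.
  by move=> _; rewrite lee_fin divr_ge0 ?ltW.
rewrite ge0_integralD//; try exact: measurable_funeM; last exact: cst0.
rewrite integral_cst//= probability_setT mule1 [leRHS]EFinD leeD2r//.
rewrite ge0_integralZl ?lee_fin//; last by move=> w _; rewrite lee_fin sqr_ge0.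
by rewrite [X in (_ <= X%:E)%E]mulrC EFinM lee_wpmul2l ?lee_fin// mean_square.
Qed.

(** The first bound is the triangle inequality in each cell. The second sums the AM-GM bound over
    the cells and optimizes the common parameter. *)
Lemma sum_deviation_le (I : finType) (B : I -> set T) (A : set T) :
  measurable A -> (forall F, measurable (B F)) -> (forall F, B F `<=` A) ->
  trivIset setT B ->
  (\int[P]_w \sum_(F : I) deviation mu (fun i => X i w) N (B F) <=
   (Num.min (2 * fine (mu A)) (Num.sqrt (#|I|%:R * fine (mu A) / N%:R)))%:E)%E.
Proof.
move=> mA mB BA tB; set q := fine (mu A).
have muq : mu A = q%:E by rewrite fineK// fin_num_measure.
have q0 : 0 <= q by rewrite fine_ge0.
have sumB : (\sum_(F : I) mu (B F) <= mu A)%E.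
  rewrite fsbig_seq ?index_enum_uniq// -measure_fin_bigcup//.
  - apply: le_measure; rewrite ?inE//; last by move=> x [F _ /BA].
    by apply: fin_bigcup_measurable => // F _.
  - exact: sub_trivIset tB.
have sumq : \sum_(F : I) fine (mu (B F)) <= q.
  rewrite -lee_fin -muq -sumEFin (le_trans _ sumB)//.
  by apply: lee_sum => F _; rewrite fineK// fin_num_measure.
rewrite ge0_integral_sum//; last 2 first.
- by move=> F; exact: measurable_deviation.
- by move=> F w _; rewrite /deviation.
rewrite /Order.min; case: ifP => _.
  apply: (@le_trans _ _ (\sum_(F : I) 2%:E * mu (B F))%E).
    by apply: lee_sum => F _; exact: deviation_le2.
  rewrite -ge0_sume_distrr// EFinM lee_wpmul2l// ?lee_fin//.
  by rewrite -muq.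
(* The parameter [s] chosen below must be positive, so an empty family and a null set [A] are
   treated apart. *)
have [I0|I0] := posnP #|I|.
  rewrite big_pred0 ?lee_fin ?sqrtr_ge0// => F.
  by have := max_card (pred1 F); rewrite I0 card1.
have I0' : (#|I|%:R : R) != 0 by rewrite pnatr_eq0 -lt0n.
have [q00|q00] := eqVneq q 0.
  rewrite q00 mulr0 mul0r sqrtr0 big1// => F _.
  apply/eqP; rewrite eq_le integral_ge0 ?andbT => [|w _]; last by rewrite /deviation.
  rewrite (le_trans (deviation_le2 (mB F)))//.
  rewrite -[leRHS](mule0 2%:E) lee_wpmul2l ?lee_fin// -[leRHS]/(0%R%:E).
  by rewrite -q00 -muq le_measure ?inE.
set r := Num.sqrt _.
(* The optimal parameter: both halves of the summed AM-GM bound become at most [r / 2]. *)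
pose s := r / #|I|%:R.
have r0 : 0 < r by rewrite sqrtr_gt0 divr_gt0 ?mulr_gt0 ?ltr0n// lt0r q00.
have s0 : 0 < s by rewrite divr_gt0// ltr0n.
apply: (@le_trans _ _ (\sum_(F : I) ((fine (mu (B F)) / N%:R) / (2 * s) + s / 2)%:E)%E).
  by apply: lee_sum => F _; exact: deviation_le_AMGM.
rewrite sumEFin lee_fin big_split /= sumr_const -mulr_suml -mulr_suml.
apply: (@le_trans _ _ ((q / N%:R) / (2 * s) + (s / 2) *+ #|I|)).
  apply: lerD; last by rewrite (_ : #|xpredT| = #|I|)//; exact: eq_card.
  by rewrite -!mulrA; apply: ler_wpM2r => //; rewrite mulr_ge0 // invr_ge0 mulr_ge0// ltW.
rewrite le_eqVlt; apply/orP; left; apply/eqP.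
have rr : q / N%:R = r ^+ 2 / #|I|%:R.
  rewrite sqr_sqrtr ?divr_ge0 ?mulr_ge0//.
  by field; rewrite Nneq0 I0'.
rewrite rr -mulr_natr /s; field; rewrite I0' gt_eqF//.
Qed.

End empirical_deviation.

(** * Annuli and dyadic cells *)

(** The tangent of exp at [t * s] lies below exp at [t] ([h1]) and at 0 ([h2]); these two bounds are
    combined with weights [s] and [1 - s]. *)
Lemma expR_convex0 (R : realType) (t s : R) : 0 <= s <= 1 ->
  expR (t * s) - 1 <= s * (expR t - 1).
Proof.
case/andP => s0 s1.
have E0 : 0 < expR (t * s) by exact: expR_gt0.
have h1 : expR (t * s) * (1 + (t - t * s)) <= expR t.
  have -> : expR t = expR (t * s) * expR (t - t * s) by rewrite -expRD addrC subrK.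
  by rewrite ler_pM2l// expR_ge1Dx.
have h2 : expR (t * s) * (1 - t * s) <= 1.
  have e1 : expR (t * s) * expR (- (t * s)) = 1 by rewrite -expRD subrr expR0.
  by rewrite -[leRHS]e1 ler_pM2l// expR_ge1Dx.
have := ler_wpM2l s0 h1; have : 0 <= 1 - s by rewrite subr_ge0.
move=> /(ler_wpM2l) /(_ _ _ h2); set e := expR (t * s); nra.
Qed.

Section euclidean.
Context (R : realType) (d : nat).
Implicit Types x y : 'rV[R]_d.

Lemma enorm_ge0 x : 0 <= enorm x.
Proof. exact: sqrtr_ge0. Qed.

Lemma enorm_sq x : enorm x ^+ 2 = \sum_(i < d) x ord0 i ^+ 2.
Proof. by rewrite sqr_sqrtr// sumr_ge0// => i _; exact: sqr_ge0. Qed.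

Lemma le_enorm x r : 0 <= r -> (enorm x <= r) = (\sum_(i < d) x ord0 i ^+ 2 <= r ^+ 2).
Proof. by move=> r0; rewrite -enorm_sq ler_sqr// nnegrE ?enorm_ge0. Qed.

Lemma coord_le_enorm x i : `|x ord0 i| <= enorm x.
Proof.
rewrite -ler_sqr ?nnegrE ?enorm_ge0// enorm_sq real_normK ?num_real//.
by rewrite (bigD1 i)//= lerDl sumr_ge0// => j _; exact: sqr_ge0.
Qed.

(** The coordinatewise bound (u - v)^2 <= 2 u^2 + 2 v^2 stands in for the triangle inequality. *)
Lemma enormB_max x y r : enorm x <= r -> enorm y <= r -> enorm (x - y) <= 2 * r.
Proof.
move=> xr yr; have r0 : 0 <= r by apply: le_trans xr; exact: enorm_ge0.
rewrite le_enorm ?mulr_ge0//.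
rewrite le_enorm// in xr; rewrite le_enorm// in yr.
apply: (@le_trans _ _ (\sum_(i < d) (2 * x ord0 i ^+ 2 + 2 * y ord0 i ^+ 2))).
  apply: ler_sum => i _; rewrite !mxE -subr_ge0.
  by rewrite (_ : _ - _ = (x ord0 i + y ord0 i) ^+ 2) ?sqr_ge0//; ring.
by rewrite big_split /= -!mulr_sumr; nra.
Qed.

Lemma enorm_le_coord x r : 0 <= r -> (forall i, `|x ord0 i| <= r) ->
  enorm x <= Num.sqrt d%:R * r.
Proof.
move=> r0 xr; rewrite le_enorm ?mulr_ge0 ?sqrtr_ge0// exprMn sqr_sqrtr//.
apply: (@le_trans _ _ (\sum_(i < d) r ^+ 2)); last first.
  by rewrite sumr_const card_ord mulr_natl.
apply: ler_sum => i _; rewrite -(real_normK (num_real (x ord0 i))).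
by rewrite lerXn2r ?nnegrE.
Qed.

Lemma measurable_coord (i : 'I_d) :
  measurable_fun setT (fun x : euclid R d => (x : 'rV[R]_d) ord0 i).
Proof.
apply: (measurability _ (RGenOpens.measurableE R)) => _ [_ [a [b ->]] <-].
rewrite setTI; apply: sub_sigma_algebra.
have := @coord_continuous R 1 d ord0 i.
by move/continuousP; apply; exact: interval_open.
Qed.

Lemma measurable_sqrt : measurable_fun setT (@Num.sqrt R).
Proof. by apply: continuous_measurable_fun; exact: sqrt_continuous. Qed.

Lemma measurable_enorm : measurable_fun setT (fun x : euclid R d => enorm x).
Proof.
apply: (measurableT_comp measurable_sqrt); apply: measurable_sum => i.
by apply: measurable_funX; exact: measurable_coord.
Qed.

Lemma measurable_euclid_dist :
  measurable_fun setT (fun z : euclid R d * euclid R d => euclid_dist z.1 z.2).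
Proof.
apply: (measurableT_comp measurable_sqrt); apply: measurable_sum => i.
apply: measurable_funX; under eq_fun do rewrite !mxE.
apply: measurable_funB; apply: (measurableT_comp (@measurable_coord i)).
  exact: measurable_fst.
exact: measurable_snd.
Qed.

Lemma ann_ex x : exists n, enorm x <= 2 ^+ n.
Proof.
exists (Num.truncn (enorm x)).+1.
rewrite (le_trans (ltW (truncnS_gt _)))// -natrX ler_nat.
by rewrite ltnW// ltn_expl.
Qed.

Definition ann x : nat := ex_minn (ann_ex x).

Lemma ann_le x n : (ann x <= n)%N = (enorm x <= 2 ^+ n).
Proof.
rewrite /ann; case: ex_minnP => m xm min; apply/idP/idP => [mn|/min//].
by rewrite (le_trans xm)// ler_weXn2l// ler1n.
Qed.

(* The argument of [truncn] is nonnegative by [coord_ann] below, so that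
   truncating is taking the floor. *)
Definition label (l : nat) x : nat * {ffun 'I_d -> nat} :=
  (ann x, [ffun i => Num.truncn (2 ^+ l * (x ord0 i / 2 ^+ (ann x) + 1))]).

Lemma coord_ann x i : -1 <= x ord0 i / 2 ^+ ann x <= 1.
Proof.
rewrite -ler_norml normrM normfV [X in _ / X]ger0_norm ?exprn_ge0//.
rewrite ler_pdivrMr ?exprn_gt0// mul1r (le_trans (coord_le_enorm _ _))//.
by rewrite -ann_le.
Qed.

Lemma measurable_level d' (T : measurableType d') (phi : T -> nat) :
  (forall n, measurable [set x | (phi x <= n)%N]) ->
  forall n, measurable (phi @^-1` [set n]).
Proof.
move=> mphi [|n].
  rewrite (_ : _ @^-1` _ = [set x | (phi x <= 0)%N])//.
  by apply/seteqP; split=> x /=; rewrite leqn0 => /eqP.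
rewrite (_ : _ @^-1` _ = [set x | (phi x <= n.+1)%N] `\` [set x | (phi x <= n)%N]).
  exact: measurableD.
apply/seteqP; split=> x /= => [->|[+ /negP]]; first by rewrite ltnn leqnn.
by rewrite -ltnNge => h1 h2; apply/eqP; rewrite eqn_leq h1.
Qed.

Lemma measurable_ann n : measurable ((ann : euclid R d -> nat) @^-1` [set n]).
Proof.
apply: (@measurable_level _ (euclid R d) (ann : euclid R d -> nat)) => m.
rewrite (_ : [set x | _] = (fun x : euclid R d => enorm x) @^-1` `]-oo, 2 ^+ m]%classic).
  by rewrite -[X in measurable X]setTI; exact: measurable_enorm.
by apply/seteqP; split=> x /=; rewrite ann_le in_itv.
Qed.

Lemma measurable_labels l k : measurable ((label l : euclid R d -> _) @^-1` [set k]).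
Proof.
case: k => n F.
pose phi i (x : euclid R d) :=
  Num.truncn (2 ^+ l * ((x : 'rV[R]_d) ord0 i / 2 ^+ n + 1)).
rewrite (_ : _ @^-1` _ = (ann : euclid R d -> nat) @^-1` [set n] `&`
   \bigcap_(i in [set: 'I_d]) (phi i @^-1` [set F i])); last first.
  apply/seteqP; split => x /=.
    by case => xn <-; split => // i _; rewrite /phi /= ffunE xn.
  case=> xn h; rewrite /label xn; congr pair; apply/ffunP => i; rewrite ffunE.
  exact: (h i).
apply: measurableI; first exact: measurable_ann.
apply: fin_bigcap_measurable => // i _.
apply: (@measurable_level _ (euclid R d) (phi i)) => m.
rewrite (_ : [set x | _] = (fun x : euclid R d =>
  2 ^+ l * ((x : 'rV[R]_d) ord0 i / 2 ^+ n + 1)) @^-1` `]-oo, m.+1%:R[%classic).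
  rewrite -[X in measurable X]setTI; suff : measurable_fun setT (fun x : euclid R d =>
    2 ^+ l * ((x : 'rV[R]_d) ord0 i / 2 ^+ n + 1)) by exact.
  apply: measurable_funM => //; apply: measurable_funD => //.
  by apply: measurable_funM => //; exact: measurable_coord.
by apply/seteqP; split=> x /=; rewrite truncn_le_nat in_itv.
Qed.

(** [truncn s] is the integer half of [truncn (2 * s)]; hence a label of depth [l.+1] determines the
    one of depth [l]. *)
Lemma truncn_halve (s t : R) : 0 <= s -> 0 <= t ->
  Num.truncn (2 * s) = Num.truncn (2 * t) -> Num.truncn s = Num.truncn t.
Proof.
suff half (r : R) : 0 <= r -> Num.truncn r = (Num.truncn (2 * r))./2.
  by move=> s0 t0 st; rewrite (half s)// (half t)// st.
move=> r0; apply: truncn_def.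
have /truncn_itv : 0 <= 2 * r by rewrite mulr_ge0.
set m := Num.truncn _; rewrite -(odd_double_half m).
move: (m./2) (odd m) => k o; rewrite half_bit_double.
rewrite -!natr1 !natrD -muln2 natrM.
case: o => /= /andP[]; nra.
Qed.

Lemma label_nested l x x' : label l.+1 x = label l.+1 x' -> label l x = label l x'.
Proof.
case=> axx /ffunP h; rewrite /label axx; congr pair; apply/ffunP => i.
have := h i; rewrite !ffunE axx !exprS -!mulrA => /truncn_halve -> //.
  have /andP[/= h1 _] := coord_ann x i; rewrite -axx.
  by rewrite mulr_ge0 ?exprn_ge0// -lerBlDr sub0r.
have /andP[/= h1 _] := coord_ann x' i.
by rewrite mulr_ge0 ?exprn_ge0// -lerBlDr sub0r.
Qed.

(** In each coordinate the rescaled points lie in a common unit interval, so the original ones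
    differ by at most the side of the cell; [sqrt d] passes from the sup norm to the Euclidean
    norm. *)
Lemma label_dist l x x' : label l x = label l x' ->
  enorm (x - x') <= Num.sqrt d%:R * (2 ^+ ann x / 2 ^+ l).
Proof.
case=> axx /ffunP h; apply: enorm_le_coord => [|i]; first by rewrite divr_ge0 ?exprn_ge0.
have := h i; rewrite !ffunE -axx => trE.
have := coord_ann x i; have := coord_ann x' i; rewrite -axx.
move=> /andP[v1 v2] /andP[u1 u2]; rewrite !mxE.
have A0 : (0 : R) < 2 ^+ ann x by rewrite exprn_gt0.
have L0 : (0 : R) < 2 ^+ l by rewrite exprn_gt0.
have : 0 <= 2 ^+ l * (x ord0 i / 2 ^+ ann x + 1).
  by rewrite mulr_ge0 ?exprn_ge0// -lerBlDr sub0r.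
have : 0 <= 2 ^+ l * (x' ord0 i / 2 ^+ ann x + 1).
  by rewrite mulr_ge0 ?exprn_ge0// -lerBlDr sub0r.
move=> /truncn_itv + /truncn_itv; rewrite trE -[(Num.truncn _).+1%:R]natr1.
move: ((Num.truncn _)%:R) => m.
have xE : x ord0 i = 2 ^+ ann x * (x ord0 i / 2 ^+ ann x).
  by rewrite mulrCA divff ?mulr1// gt_eqF.
have x'E : x' ord0 i = 2 ^+ ann x * (x' ord0 i / 2 ^+ ann x).
  by rewrite mulrCA divff ?mulr1// gt_eqF.
clear v1 v2 u1 u2; move: (x ord0 i / 2 ^+ ann x) (x' ord0 i / 2 ^+ ann x) xE x'E.
move=> u v -> -> /andP[h1 h2] /andP[h3 h4]; rewrite -mulrBr normrM gtr0_norm// ler_pM2l//.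
rewrite -[_^-1]mul1r ler_pdivlMr// -[X in _ * X](gtr0_norm L0) -normrM ler_norml.
move: (2 ^+ l) h1 h2 h3 h4 => L; rewrite !mulrDr !mulr1 mulrBl -!(mulrC L).
clear A0 L0 trE h axx => h1 h2 h3 h4; by apply/andP; split; lra.
Qed.

Lemma label_fst l x : (label l x).1 = ann x.
Proof. by []. Qed.

(** The rescaled coordinates lie in the closed interval from 0 to 2^(l+1), so the truncation may
    equal 2^(l+1) itself; [2 ^ l.+2] leaves room for it and keeps the count a power of two. *)
Definition cell_label (l n : nat) (F : {ffun 'I_d -> 'I_(2 ^ l.+2)}) :
  nat * {ffun 'I_d -> nat} := (n, [ffun i => val (F i)]).

Lemma label_cell l x : exists F, label l x = @cell_label l (ann x) F.
Proof.
have bd i : (Num.truncn (2 ^+ l * (x ord0 i / 2 ^+ ann x + 1)) < 2 ^ l.+2)%N.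
  have /andP[h1 h2] := coord_ann x i.
  have L0 : (0 : R) < 2 ^+ l by rewrite exprn_gt0.
  rewrite truncn_lt_nat; last by rewrite mulr_ge0 ?exprn_ge0// -lerBlDr sub0r.
  rewrite natrX !exprS; move: (2 ^+ l) (x ord0 i / _) L0 h1 h2 => L u L0 h1 h2; nra.
exists [ffun i => Ordinal (bd i)]; congr pair.
by apply/ffunP => i; rewrite !ffunE.
Qed.

Lemma cell_label_inj l n F G : @cell_label l n F = @cell_label l n G -> F = G.
Proof.
case=> /ffunP h; apply/ffunP => i; apply: val_inj.
by have := h i; rewrite !ffunE.
Qed.

Lemma card_cells l : #|{ffun 'I_d -> 'I_(2 ^ l.+2)}| = ((2 ^ l.+2) ^ d)%N.
Proof. by rewrite card_ffun !card_ord. Qed.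

Section cost.
Context (a p : R) (a0 : 0 < a) (p1 : 1 <= p).

Let p0 : 0 <= p.
Proof. exact: le_trans p1. Qed.

Definition cost (z : euclid R d * euclid R d) : R :=
  expR (a * euclid_dist z.1 z.2 `^ p) - 1.

(** [2 ^+ n.+1] is the diameter of the ball of radius [2 ^+ n], so this dominates the cost between
    any two of its points. *)
Definition weight (n : nat) : R := expR (a * (2 ^+ n.+1) `^ p).

Lemma measurable_cost : measurable_fun setT cost.
Proof.
apply: measurable_funB => //; apply: (measurableT_comp (@measurable_expR R)).
apply: measurable_funM => //; apply: (measurableT_comp (measurable_powR p)).
exact: measurable_euclid_dist.
Qed.

Lemma cost_ge0 z : 0 <= cost z.
Proof.
rewrite subr_ge0 -[X in X <= _]expR0 ler_expR mulr_ge0 ?powR_ge0//; exact: ltW.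
Qed.

Lemma weight_gt0 n : 0 < weight n.
Proof. exact: expR_gt0. Qed.

Lemma cost_le_weight x x' n : (ann x <= n)%N -> (ann x' <= n)%N ->
  cost (x, x') <= weight n.
Proof.
rewrite !ann_le => xn x'n; rewrite lerBlDr (@le_trans _ _ (weight n))//.
  rewrite ler_expR ler_wpM2l ?(ltW a0)// ge0_ler_powR// ?nnegrE ?enorm_ge0 ?exprn_ge0//.
  by rewrite exprS; exact: enormB_max.
by rewrite lerDl.
Qed.

Lemma cost_le_weights x x' : cost (x, x') <= weight (ann x) + weight (ann x').
Proof.
have [h|/ltnW h] := leqP (ann x) (ann x').
  by rewrite (le_trans (cost_le_weight h (leqnn _)))// lerDr ltW// weight_gt0.
by rewrite (le_trans (cost_le_weight (leqnn _) h))// lerDl ltW// weight_gt0.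
Qed.

(** Let [s] be the distance divided by the diameter of the ball, so that [s <= 1] and [s] is at most
    [sqrt d] times 2^(-l). Convexity of exp pulls the factor s^p out of the exponent, leaving s^p
    times the weight of the annulus. *)
Lemma cost_le_label l x x' : label l x = label l x' ->
  cost (x, x') <= (Num.sqrt d%:R) `^ p * (2 `^ (- p)) ^+ l *
     (weight (ann x) + weight (ann x')).
Proof.
move=> lxx; have axx : ann x' = ann x by case: lxx.
have A0 : (0 : R) < 2 ^+ (ann x).+1 by rewrite exprn_gt0.
pose s := euclid_dist x x' / 2 ^+ (ann x).+1.
have s0 : 0 <= s by rewrite divr_ge0 ?enorm_ge0// ltW.
have s1 : s <= 1.
  rewrite ler_pdivrMr// mul1r exprS; apply: enormB_max; rewrite -ann_le//.
  by rewrite axx.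
have dE : euclid_dist x x' = 2 ^+ (ann x).+1 * s.
  by rewrite mulrCA divff ?mulr1// gt_eqF.
have sl : s <= Num.sqrt d%:R * (2 ^+ l)^-1.
  rewrite ler_pdivrMr// (le_trans (label_dist lxx))// -[leRHS]mulrA.
  rewrite ler_wpM2l ?sqrtr_ge0// [leLHS]mulrC ler_wpM2l ?invr_ge0 ?exprn_ge0//.
  by rewrite exprS ler_peMl ?exprn_ge0// ler1n.
have sp : s `^ p <= (Num.sqrt d%:R) `^ p * (2 `^ (- p)) ^+ l.
  have -> : 2 `^ (- p) ^+ l = ((2 ^+ l)^-1 : R) `^ p.
    by rewrite -powR_invn// -powRrM -powR_mulrn ?powR_ge0// -powRrM !mulNr mulrC.
  by rewrite -powRM ?sqrtr_ge0 ?invr_ge0 ?exprn_ge0// ge0_ler_powR// nnegrE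
    ?mulr_ge0 ?sqrtr_ge0 ?invr_ge0 ?exprn_ge0.
rewrite /cost /= dE powRM ?(ltW A0)// mulrA.
apply: (le_trans (expR_convex0 _ _)).
  have e1 : (1 : R) `^ p = 1 by rewrite powR1.
  by rewrite powR_ge0/= -[leRHS]e1 ge0_ler_powR// nnegrE.
rewrite -/(weight _) axx -mulr2n.
apply: (@le_trans _ _ (s `^ p * weight (ann x))).
  by rewrite ler_wpM2l ?powR_ge0// gerBl.
have w0 := ltW (weight_gt0 (ann x)).
apply: (le_trans (ler_wpM2r w0 sp)).
apply: ler_wpM2l; first by rewrite mulr_ge0 ?exprn_ge0 ?powR_ge0.
by rewrite mulr2n lerDl.
Qed.

End cost.

End euclidean.

(** * Sums over the scales *)

Section series_bounds.
Context (R : realType).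
Implicit Types (r g x Z tau q : R).

Lemma powR_exprn x q n : 0 <= x -> (x `^ q) ^+ n = (x ^+ n) `^ q.
Proof.
move=> x0; rewrite -[LHS]powR_mulrn ?powR_ge0// -(powR_mulrn n x0) -!powRrM.
by rewrite (mulrC q).
Qed.

Lemma geometric_sum_le r m : 0 <= r < 1 -> \sum_(0 <= l < m) r ^+ l <= (1 - r)^-1.
Proof.
case/andP => r0 r1; have r1' : 0 < 1 - r by rewrite subr_gt0.
suff -> : \sum_(0 <= l < m) r ^+ l = (1 - r ^+ m) / (1 - r).
  by rewrite ler_pdivrMr// mulVf ?gt_eqF// gerBl exprn_ge0.
elim: m => [|m IH]; first by rewrite big_geq// expr0 subrr mul0r.
by rewrite big_nat_recr//= IH exprS; field; rewrite gt_eqF.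
Qed.

Lemma min_interpolation (u v t : R) : 0 < u -> 0 < v -> 0 <= t <= 1 ->
  Num.min u v <= u `^ (1 - t) * v `^ t.
Proof.
move=> u0 v0 /andP[t0 t1].
have s0 : 0 <= 1 - t by rewrite subr_ge0.
have split z : 0 < z -> z = z `^ (1 - t) * z `^ t.
  move=> z0; rewrite -powRD ?subrK ?powRr1 ?ltW//.
  by apply/implyP => _; rewrite gt_eqF.
rewrite /Order.min; case: ltP => uv.
  by rewrite {1}(split u)// ler_wpM2l ?powR_ge0// ge0_ler_powR// ?nnegrE ltW.
by rewrite {1}(split v)// ler_wpM2r ?powR_ge0// ge0_ler_powR// ?nnegrE// ltW.
Qed.

(** Replacing the minimum by the geometric mean with exponent [2 * tau] on its second entry leaves a
    geometric series, convergent by assumption; the square root turns [2 * tau] into the exponent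
    [tau] of [x / N]. *)
Lemma scale_sum_interpolation r g x (N : nat) tau m :
  0 < r -> 0 < g -> 0 <= tau -> tau <= 2^-1 -> r * g `^ (2 * tau) < 1 ->
  0 <= x -> (0 < N)%N ->
  \sum_(0 <= l < m) r ^+ l * Num.min x (g ^+ l * Num.sqrt (x / N%:R)) <=
  (1 - r * g `^ (2 * tau))^-1 * (N%:R `^ (- tau) * x `^ (1 - tau)).
Proof.
move=> r0 g0 t0 t1 rg1; rewrite le_eqVlt => /predU1P[<-|x0] N0.
  rewrite big1 => [|l _].
    by rewrite !mulr_ge0 ?powR_ge0// invr_ge0 subr_ge0 ltW.
  by rewrite mul0r sqrtr0 mulr0 minxx mulr0.
have N0' : 0 < (N%:R : R) by rewrite ltr0n.
have xN0 : 0 < x / N%:R by rewrite divr_gt0.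
apply: (@le_trans _ _ (\sum_(0 <= l < m) (r * g `^ (2 * tau)) ^+ l *
    (N%:R `^ (- tau) * x `^ (1 - tau)))); last first.
  rewrite -mulr_suml ler_wpM2r ?mulr_ge0 ?powR_ge0// geometric_sum_le//.
  by rewrite rg1 mulr_ge0 ?powR_ge0// ltW.
apply: ler_sum => l _; rewrite exprMn -mulrA ler_wpM2l ?exprn_ge0 ?(ltW r0)//.
have gl0 : 0 < g ^+ l by rewrite exprn_gt0.
apply: (le_trans (@min_interpolation _ _ (2 * tau) _ _ _)) => //.
- by rewrite mulr_gt0// sqrtr_gt0.
- by apply/andP; split; lra.
rewrite powRM ?sqrtr_ge0 ?(ltW gl0)// -powR12_sqrt ?(ltW xN0)// -powRrM.
rewrite (_ : 2^-1 * (2 * tau) = tau); last by field.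
rewrite powRM ?(ltW x0) ?invr_ge0 ?(ltW N0')//.
rewrite -[g ^+ l]powR_mulrn ?(ltW g0)// -[(g `^ _) ^+ l]powR_mulrn ?powR_ge0//.
rewrite -!powRrM (mulrC l%:R).
rewrite -[(N%:R)^-1]powR_inv1 ?(ltW N0')// -powRrM mulN1r.
rewrite (_ : x `^ (1 - tau) = x `^ (1 - 2 * tau) * x `^ tau); last first.
  rewrite -powRD; first by congr powR; ring.
  by apply/implyP => _; rewrite gt_eqF.
by rewrite le_eqVlt; apply/orP; left; apply/eqP; ring.
Qed.

(** When [r * g = 1] the second entry of the minimum contributes equally at each of the [m] scales;
    this is the source of the logarithm. *)
Lemma scale_sum_critical r g x (N : nat) m : 0 < r -> r * g = 1 -> 0 <= x ->
  \sum_(0 <= l < m) r ^+ l * Num.min x (g ^+ l * Num.sqrt (x / N%:R)) <=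
  m%:R * (N%:R `^ (- 2^-1) * x `^ (1 - 2^-1)).
Proof.
move=> r0 rg x0; apply: (@le_trans _ _ (\sum_(0 <= l < m) Num.sqrt (x / N%:R))).
  apply: ler_sum => l _; have e : Num.sqrt (x / N%:R) =
      r ^+ l * (g ^+ l * Num.sqrt (x / N%:R)).
    by rewrite mulrA -exprMn rg expr1n mul1r.
  rewrite [leRHS]e.
  by rewrite ler_wpM2l ?exprn_ge0 ?(ltW r0)// ge_min lexx orbT.
rewrite big_const_nat subn0 iter_addr_0 -[leLHS]mulr_natl.
rewrite sqrtrM// sqrtrV//.
rewrite powRN -!powR12_sqrt//.
rewrite (_ : 1 - 2^-1 = 2^-1 :> R); last by field.
by rewrite [X in _ <= _ * X]mulrC.
Qed.

(* Below the scale [g ^+ l = Z] the terms grow geometrically, above it they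
   decay geometrically, and at that scale they are of order [Z `^ (- q)]. *)
Lemma threshold_sum r g q : 1 < g -> 0 < q < 1 -> r = g `^ (- q) ->
  exists C, 0 < C /\ forall Z m, 0 < Z ->
    \sum_(0 <= l < m) r ^+ l * Num.min 1 (g ^+ l / Z) <= C * Z `^ (- q).
Proof.
move=> g1 /andP[q0 q1] rE.
have g0 : 0 < g by apply: lt_trans g1.
have rl l : r ^+ l = (g ^+ l) `^ (- q).
  by rewrite rE powR_exprn ?(ltW g0).
have rgE : r * g = g `^ (1 - q).
  rewrite rE -{2}[g]powRr1 ?(ltW g0)// -powRD; first by rewrite addrC.
  by apply/implyP => _; rewrite gt_eqF.
have rgl l : (r * g) ^+ l = (g ^+ l) `^ (1 - q).
  by rewrite rgE powR_exprn ?(ltW g0).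
have r0 : 0 < r by rewrite rE powR_gt0.
have p1 (z : R) : 1 `^ z = 1 by rewrite powR1.
have r1 : r < 1.
  by rewrite rE powRN invf_lt1 ?powR_gt0// -[ltLHS](p1 q) gt0_ltr_powR ?nnegrE// ltW.
have rg1 : 1 < r * g.
  by rewrite rgE -[ltLHS](p1 (1 - q)) gt0_ltr_powR ?nnegrE ?subr_gt0// ltW.
pose A := (r * g - 1)^-1; pose B := (1 - r)^-1.
have A0 : 0 < A by rewrite invr_gt0 subr_gt0.
have B0 : 0 < B by rewrite invr_gt0 subr_gt0.
have AE : A * (r * g) = A + 1.
  by rewrite /A; field; rewrite gt_eqF// subr_gt0.
have BE : B * r = B - 1.
  by rewrite /B; field; rewrite gt_eqF// subr_gt0.
have q10 : 0 <= 1 - q by rewrite subr_ge0 ltW.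
exists (A * g `^ (1 - q) + B); split; first by rewrite addr_gt0// mulr_gt0// powR_gt0.
move=> Z m Z0.
have anti (s t : R) : 0 < s -> s <= t -> t `^ (- q) <= s `^ (- q).
  move=> s0 st; have t0 := lt_le_trans s0 st.
  rewrite !powRN lef_pV2 ?posrE ?powR_gt0//.
  by rewrite ge0_ler_powR ?nnegrE ?(ltW q0) ?(ltW s0) ?(ltW t0).
have ZE : Z `^ (1 - q) / Z = Z `^ (- q).
  rewrite powRD; last by apply/implyP => _; rewrite gt_eqF.
  by rewrite powRr1 ?(ltW Z0)// mulrAC divff ?mul1r// gt_eqF.
(* The growing part is a geometric sum dominated by its last term, the one with the largest
   [g ^+ l <= Z]; the factor [g] in [g * Z] covers the shift to the next index. *)
have S1 : \sum_(0 <= l < m) (if g ^+ l <= Z then (r * g) ^+ l else 0) <=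
    A * (g * Z) `^ (1 - q).
  have geo k : \sum_(0 <= l < k) (if g ^+ l <= Z then (r * g) ^+ l else 0) <=
      A * (r * g) ^+ k.
    elim: k => [|k IH]; first by rewrite big_geq// expr0 mulr1 ltW.
    rewrite big_nat_recr//= exprS mulrA AE mulrDl mul1r lerD//.
    by case: ifP => // _; rewrite exprn_ge0// ltW// (lt_trans _ rg1).
  elim: m => [|m IH]; first by rewrite big_geq// mulr_ge0 ?powR_ge0// ltW.
  have [gZ|gZ] := leP (g ^+ m) Z; last first.
    by rewrite big_nat_recr//= [g ^+ m <= Z]leNgt gZ /= addr0.
  rewrite (le_trans (geo _))// ler_wpM2l ?(ltW A0)// rgl ge0_ler_powR ?nnegrE//.
  - by rewrite exprn_ge0// ltW.
  - by rewrite mulr_ge0// ltW.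
  - by rewrite exprS ler_wpM2l// ltW.
(* The decaying part. The subtracted [r ^+ m] makes the induction telescope through [B * r = B - 1],
   and the case distinction covers the indices before the threshold. *)
have S2 : \sum_(0 <= l < m) (if g ^+ l <= Z then 0 else r ^+ l) <=
    (if g ^+ m <= Z then 0 else B * (Z `^ (- q) - r ^+ m)).
  elim: m {S1} => [|m IH].
    rewrite big_geq//; case: (leP (g ^+ 0) Z) => // gZ.
    rewrite mulr_ge0 ?(ltW B0)// subr_ge0 rl; apply: anti => //; exact: ltW.
  rewrite big_nat_recr//=; case: (leP (g ^+ m) Z) IH => gZ IH.
    rewrite addr0; apply: (le_trans IH); case: (leP (g ^+ m.+1) Z) => // gZ'.
    rewrite mulr_ge0 ?(ltW B0)// subr_ge0 rl; apply: anti => //; exact: ltW.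
  rewrite [g ^+ m.+1 <= Z]leNgt (lt_trans gZ) ?ltr_eXn2l//=.
  apply: (@le_trans _ _ (B * (Z `^ (- q) - r ^+ m) + r ^+ m)); first by rewrite lerD2r.
  by rewrite exprS !mulrBr mulrA BE; lra.
apply: (@le_trans _ _ (\sum_(0 <= l < m)
    ((if g ^+ l <= Z then (r * g) ^+ l else 0) / Z +
     (if g ^+ l <= Z then 0 else r ^+ l)))).
  apply: ler_sum => l _; case: (leP (g ^+ l) Z) => gZ; rewrite ?addr0 ?mul0r ?add0r.
    by rewrite exprMn -mulrA ler_wpM2l ?exprn_ge0 ?(ltW r0)// ge_min lexx orbT.
  by rewrite -[leRHS]mulr1 ler_wpM2l ?exprn_ge0 ?(ltW r0)// ge_min lexx.
rewrite big_split /= -mulr_suml mulrDl lerD//.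
  rewrite ler_pdivrMr// (le_trans S1)// powRM ?(ltW g0) ?(ltW Z0)// -ZE.
  by rewrite -!mulrA mulVf ?mulr1// gt_eqF.
apply: (le_trans S2); case: (leP (g ^+ m) Z) => _.
  by rewrite mulr_ge0 ?powR_ge0// ltW.
by rewrite ler_wpM2l ?(ltW B0)// gerBl exprn_ge0// ltW.
Qed.

(** Factoring out [x] turns the square root of [x / N] into the inverse of Z, the square root of
    [x * N], which is the situation of [threshold_sum]; then Z^(-q) = (x N)^(-q/2). *)
Lemma scale_sum_supercritical r g q : 1 < g -> 0 < q < 1 -> r = g `^ (- q) ->
  exists C, 0 < C /\ forall x (N : nat) m, 0 <= x -> (0 < N)%N ->
  \sum_(0 <= l < m) r ^+ l * Num.min x (g ^+ l * Num.sqrt (x / N%:R)) <=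
  C * (N%:R `^ (- (q / 2)) * x `^ (1 - q / 2)).
Proof.
move=> g1 q01 rE; have [C [C0 HC]] := threshold_sum g1 q01 rE.
exists C; split => // x N m; rewrite le_eqVlt => /predU1P[<-|x0] N0.
  rewrite big1 => [|l _]; first by rewrite mulr_ge0 ?mulr_ge0 ?powR_ge0// ltW.
  by rewrite mul0r sqrtr0 mulr0 minxx mulr0.
have N0' : 0 < (N%:R : R) by rewrite ltr0n.
have xN : 0 < x * N%:R by rewrite mulr_gt0.
have sq : Num.sqrt (x / N%:R) = x / Num.sqrt (x * N%:R).
  apply/eqP; rewrite -(eqrXn2 (n := 2)) ?sqrtr_ge0 ?divr_ge0 ?(ltW x0)//.
  rewrite exprMn exprVn !sqr_sqrtr ?divr_ge0 ?(ltW x0) ?(ltW xN)//.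
  by apply/eqP; field; rewrite !gt_eqF.
have -> : \sum_(0 <= l < m) r ^+ l * Num.min x (g ^+ l * Num.sqrt (x / N%:R)) =
    x * \sum_(0 <= l < m) r ^+ l * Num.min 1 (g ^+ l / Num.sqrt (x * N%:R)).
  rewrite mulr_sumr; apply: eq_bigr => l _; rewrite sq [RHS]mulrCA; congr (_ * _).
  by rewrite minr_pMr ?(ltW x0)// mulr1 mulrCA.
have Z0 : 0 < Num.sqrt (x * N%:R) by rewrite sqrtr_gt0.
apply: (le_trans (ler_wpM2l (ltW x0) (HC _ m Z0))).
rewrite -powR12_sqrt ?(ltW xN)// -powRrM powRM ?(ltW x0) ?(ltW N0')//.
rewrite (_ : 2^-1 * - q = - (q / 2)); last by field.
rewrite powRD; last by apply/implyP => _; rewrite gt_eqF.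
by rewrite powRr1 ?(ltW x0)// le_eqVlt; apply/orP; left; apply/eqP; ring.
Qed.

End series_bounds.

(** * Sums over the annuli *)

Lemma nneseries_le_partial (R : realType) (u : nat -> \bar R) (S : \bar R) :
  (forall n, (0 <= u n)%E) -> (forall m, (\sum_(0 <= n < m) u n <= S)%E) ->
  (\sum_(n <oo) u n <= S)%E.
Proof.
move=> u0 uS; apply: lime_le; first by apply: is_cvg_nneseries => n _ _.
by apply: nearW => m; exact: uS.
Qed.

(* Applied to [exp_cost] as a function of the sample, whose measurability is not
   proved here: the integral of a nonnegative function is a supremum over the
   simple functions below it. *)
Lemma ge0_le_integral_nomeas d (T : measurableType d) (R : realType)
    (mu : {measure set T -> \bar R}) (f g : T -> \bar R) :
  (forall x, (0 <= f x)%E) -> (forall x, (f x <= g x)%E) ->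
  (\int[mu]_x f x <= \int[mu]_x g x)%E.
Proof.
move=> f0 fg; have g0 x : (0 <= g x)%E := le_trans (f0 x) (fg x).
rewrite !ge0_integralTE//; apply: le_ereal_sup; apply: image_subset => h /= hf x.
exact: le_trans (hf x) (fg x).
Qed.

Section moment.
Context (R : realType) (d : nat) (a p b E : R) (p1 : 1 <= p).

Definition annulus (n : nat) : set (euclid R d) :=
  (@ann R d : euclid R d -> nat) @^-1` [set n].

(** Markov's inequality: points of the annulus of index [n.+1] have norm larger than [2 ^+ n]. *)
Lemma annulus_tail (mu : probability (euclid R d) R) n :
  0 <= b -> (\int[mu]_y (expR (b * enorm y `^ p))%:E = E%:E)%E ->
  fine (mu (annulus n.+1)) <= E * expR (- (b * (2 ^+ n) `^ p)).
Proof.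
move=> b0 muE.
have mA : measurable (annulus n.+1) by exact: measurable_ann.
have mf : measurable_fun setT (fun y : euclid R d => (expR (b * enorm y `^ p))%:E).
  apply/measurable_EFinP; apply: (measurableT_comp (@measurable_expR R)).
  apply: measurable_funM => //; apply: (measurableT_comp (measurable_powR p)).
  exact: measurable_enorm.
rewrite expRN ler_pdivlMr ?expR_gt0// -lee_fin mulrC EFinM.
rewrite fineK ?fin_num_measure// -muE -(integral_cst mu mA (expR _)%:E).
apply: (@le_trans _ _ (\int[mu]_(y in annulus n.+1) (expR (b * enorm y `^ p))%:E)%E).
  apply: ge0_le_integral; first exact: mA.
  - by move=> y _; rewrite lee_fin expR_ge0.
  - exact: measurable_cst.
  - exact: measurable_funTS.
  - move=> y /= ya; rewrite lee_fin ler_expR ler_wpM2l//.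
    rewrite ge0_ler_powR ?nnegrE ?enorm_ge0 ?exprn_ge0// ?(le_trans _ p1)//.
    by rewrite ltW// ltNge -ann_le ya ltnn.
by apply: ge0_subset_integral => // y _; rewrite lee_fin expR_ge0.
Qed.

(** With t = 2^(np), the weight of index n + 1 is exp(4^p a t) and the power of the mass is at most
    |E|^sg exp(-sg b t). As t >= n, the product is at most |E|^sg z^n with z < 1. The unit ball has
    no tail bound and contributes at most [weight a p 0]. [S] is chosen before [mu], when the sign
    of [E] is not yet known, hence the absolute value. *)
Lemma weight_moment_series (sg : R) : 0 < sg -> 4 `^ p * a < sg * b -> 0 <= b ->
  exists S : R, 0 < S /\ forall mu : probability (euclid R d) R,
    (\int[mu]_y (expR (b * enorm y `^ p))%:E = E%:E)%E ->
    (\sum_(n <oo) (weight a p n * fine (mu (annulus n)) `^ sg)%:E <= S%:E)%E.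
Proof.
move=> sg0 sgb b0; pose kp := sg * b - 4 `^ p * a.
have kp0 : 0 < kp by rewrite subr_gt0.
pose z := expR (- kp).
have z0 : 0 <= z by exact: expR_ge0.
have z1 : z < 1 by rewrite -[ltRHS]expR0 ltr_expR oppr_lt0.
have z1' : 0 < 1 - z by rewrite subr_gt0.
exists (weight a p 0 + `|E| `^ sg * (1 - z)^-1); split.
  by rewrite ltr_wpDr ?weight_gt0// mulr_ge0 ?powR_ge0// invr_ge0 ltW.
move=> mu muE.
have x0 n : 0 <= fine (mu (annulus n)) by rewrite fine_ge0.
have x1 n : fine (mu (annulus n)) <= 1.
  rewrite -lee_fin fineK ?fin_num_measure ?probability_le1//; exact: measurable_ann.
have u0 n : 0 <= weight a p n * fine (mu (annulus n)) `^ sg.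
  by rewrite mulr_ge0 ?powR_ge0// ltW// weight_gt0.
apply: nneseries_le_partial => [n|m]; first by rewrite lee_fin.
have uS n : weight a p n.+1 * fine (mu (annulus n.+1)) `^ sg <= `|E| `^ sg * z ^+ n.
  pose t : R := (2 ^+ n) `^ p.
  have tn : n%:R <= t.
    rewrite (@le_trans _ _ (2 ^+ n))//; first by rewrite -natrX ler_nat ltnW// ltn_expl.
    by rewrite /t -[leLHS]powRr1 ?exprn_ge0// ler_powR// exprn_ege1// ler1n.
  have wE : weight a p n.+1 = expR (4 `^ p * a * t).
    rewrite /weight; congr expR; rewrite !exprS mulrA powRM ?exprn_ge0// -/t.
    by rewrite -natrM mulrCA mulrA.
  apply: (@le_trans _ _ (expR (4 `^ p * a * t) * (`|E| * expR (- (b * t))) `^ sg)).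
    rewrite wE; apply: ler_wpM2l; first exact: expR_ge0.
    apply: ge0_ler_powR; first exact: ltW.
    - by rewrite nnegrE.
    - by rewrite nnegrE mulr_ge0// expR_ge0.
    apply: (le_trans (annulus_tail n b0 muE)).
    apply: ler_wpM2r; first exact: expR_ge0.
    exact: ler_norm.
  rewrite powRM; [|by []|exact: expR_ge0].
  rewrite mulrCA; apply: ler_wpM2l; first exact: powR_ge0.
  rewrite [X in _ * X]/powR gt_eqF ?expR_gt0// expRK -expRD.
  rewrite /z -expRM_natl ler_expR.
  by rewrite /kp; have := ler_wpM2l (ltW kp0) tn; rewrite /kp; lra.
case: m => [|m].
  rewrite big_geq// lee_fin addr_ge0 ?mulr_ge0 ?powR_ge0//.
    by rewrite ltW// weight_gt0.
  by rewrite invr_ge0 ltW.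
rewrite big_nat_recl// EFinD; apply: leeD.
  rewrite lee_fin ler_piMr// ?(ltW (weight_gt0 _ _ _))//.
  rewrite -[leRHS](powRr0 1%R) powRr0.
  have e1 : (1 : R) `^ sg = 1 by rewrite powR1.
  by rewrite -[leRHS]e1 ge0_ler_powR ?nnegrE// ltW.
rewrite sumEFin lee_fin.
apply: (@le_trans _ _ (\sum_(0 <= n < m) `|E| `^ sg * z ^+ n)).
  by apply: ler_sum => n _.
by rewrite -mulr_sumr ler_wpM2l ?powR_ge0// geometric_sum_le// z0.
Qed.

End moment.

(** * Expected cost in terms of the masses of the annuli *)

Section expected_cost.
Context (R : realType) (d : nat) (a p : R) (a0 : 0 < a) (p1 : 1 <= p).

Local Notation W := (weight a p).
Local Notation eul := (euclid R d).

Definition scale_coef (l : nat) : R := Num.sqrt d%:R `^ p * (2 `^ (- p)) ^+ l.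

Lemma scale_coef_ge0 l : 0 <= scale_coef l.
Proof. by rewrite mulr_ge0 ?exprn_ge0 ?powR_ge0. Qed.

Definition level_deviation (mu : probability eul R) (y : nat -> eul) (N l : nat)
    : \bar R :=
  (\sum_(n <oo) (W n)%:E * \sum_(F : {ffun 'I_d -> 'I_(2 ^ l.+2)})
     deviation mu y N ((@label R d l : eul -> _) @^-1` [set @cell_label d l n F]))%E.

Lemma measurable_weight_ann :
  measurable_fun setT (fun x : eul => W (ann x)).
Proof.
exact: (measurable_label (kap := (@ann R d : eul -> nat)) W (@measurable_ann R d)).
Qed.

Lemma exp_cost_le_levels (mu : probability eul R) (y : nat -> eul) (N L : nat) :
  (0 < N)%N ->
  (exp_cost p a mu (empirical y N) <=
    (scale_coef L)%:E * (\int[mu]_x (W (ann x))%:E +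
       (N%:R^-1 * \sum_(i < N) W (ann (y i)))%:E) +
    \sum_(0 <= l < L) (scale_coef l)%:E * level_deviation mu y N l.+1 +
    level_deviation mu y N 0)%E.
Proof.
move=> N0.
have [pi [pi1 pi2 pi3]] := @multilevel_coupling _ eul R mu
  (nat * {ffun 'I_d -> nat})%type y N L (@cost R d a p)
  (fun l => (@label R d l : eul -> _)) (0%N, [ffun=> 0%N])
  (fun x => W (ann x)) scale_coef (level_deviation mu y N) N0
  (measurable_cost a p) (cost_ge0 p a0)
  (@measurable_labels R d)
  (fun l x x' => @label_nested R d l x x')
  measurable_weight_ann (fun x => ltW (weight_gt0 a p _)) scale_coef_ge0
  (fun l x x' h => cost_le_label a p1 h)
  (fun x x' => cost_le_weights a0 p1 x x')
  (fun l f g h => @balanced_weight _ eul R mu _ _ y N (@label R d l : eul -> _)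
     fst (@cell_label d l) W f g h (fun n => ltW (weight_gt0 a p n))
     (@measurable_labels R d l) (fun x => @label_cell R d l x)).
apply: le_trans pi3; apply: ereal_inf_lbound; exists pi => //; split => // A mA.
rewrite pi2// /empirical /= /mscale /= /msum.
by rewrite ge0_sume_distrr.
Qed.

Lemma exp_cost_ge0 (mu nu : {measure set eul -> \bar R}) :
  (0 <= exp_cost p a mu nu)%E.
Proof.
apply: le_ereal_inf_tmp => _ [pi _ <-]; apply: integral_ge0 => z _.
by rewrite lee_fin; exact: (cost_ge0 p a0 z).
Qed.

Lemma integral_weight_ann (mu : probability eul R) :
  (\int[mu]_x (W (ann x))%:E =
   \sum_(n <oo) (W n * fine (mu (@annulus R d n)))%:E)%E.
Proof.
have cov : \bigcup_n (@annulus R d n) = setT.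
  by apply/seteqP; split => // x _; exists (ann x).
have mA n : measurable (@annulus R d n) by exact: measurable_ann.
rewrite -cov ge0_integral_bigcup//; last 3 first.
- by rewrite cov; apply/measurable_EFinP; exact: measurable_weight_ann.
- by move=> x _; rewrite lee_fin ltW// weight_gt0.
- apply/trivIsetP => i j _ _ ij; apply/seteqP; split => // x [/= xi xj].
  by move: ij; rewrite -xi -xj eqxx.
apply: eq_eseriesr => n _.
rewrite EFinM fineK ?fin_num_measure// -(integral_cst mu (mA n) (W n)%:E).
by apply: eq_integral => x; rewrite inE /= => ->.
Qed.

(** The bound of [sum_deviation_le] for the cells of depth [l] in an annulus of mass [x]. *)
Definition cell_bound (N l : nat) (x : R) : R :=
  Num.min (2 * x) (Num.sqrt (((2 ^ l.+2) ^ d)%:R * x / N%:R)).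

Lemma cell_bound_ge0 N l x : 0 <= x -> 0 <= cell_bound N l x.
Proof. by move=> x0; rewrite le_min sqrtr_ge0 mulr_ge0. Qed.

Context (dO : measure_display) (O : measurableType dO) (P : probability O R)
  (X : nat -> {RV P >-> eul}) (mu : probability eul R)
  (iid : iid_with_law X mu) (N : nat) (N0 : (0 < N)%N).

Lemma measurable_level_deviation l :
  measurable_fun setT (fun w => level_deviation mu (fun i => X i w) N l).
Proof.
apply: ge0_emeasurable_sum => [n w _ _|n _].
  apply: mule_ge0; first by rewrite lee_fin ltW// weight_gt0.
  by apply: sume_ge0 => F _; rewrite /deviation.
apply: measurable_funeM; apply: emeasurable_sum => F.
by apply: measurable_deviation; exact: measurable_labels.
Qed.

Lemma level_deviation_ge0 y l : (0 <= level_deviation mu y N l)%E.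
Proof.
apply: nneseries_ge0 => n _ _; apply: mule_ge0.
  by rewrite lee_fin ltW// weight_gt0.
by apply: sume_ge0 => F _; rewrite /deviation.
Qed.

Lemma expected_level_deviation l :
  (\int[P]_w level_deviation mu (fun i => X i w) N l <=
   \sum_(n <oo) (W n * cell_bound N l (fine (mu (@annulus R d n))))%:E)%E.
Proof.
have mL k := @measurable_labels R d l k.
have mD n : measurable_fun setT (fun w : O =>
    \sum_(F : {ffun 'I_d -> 'I_(2 ^ l.+2)})
     deviation mu (fun i => X i w) N
       ((@label R d l : eul -> _) @^-1` [set @cell_label d l n F]))%E.
  by apply: emeasurable_sum => F; apply: measurable_deviation; exact: mL.
have D0 n w : (0 <= \sum_(F : {ffun 'I_d -> 'I_(2 ^ l.+2)})
     deviation mu (fun i => X i w) N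
       ((@label R d l : eul -> _) @^-1` [set @cell_label d l n F]))%E.
  by apply: sume_ge0 => F _; rewrite /deviation.
have W0 n : (0 <= (W n)%:E)%E by rewrite lee_fin ltW// weight_gt0.
rewrite integral_nneseries//; last 2 first.
- by move=> n; exact: measurable_funeM.
- by move=> n w _; exact: mule_ge0.
apply: lee_nneseries => [n _ _|n _].
  by apply: integral_ge0 => w _; exact: mule_ge0.
rewrite ge0_integralZl// EFinM lee_wpmul2l// /cell_bound -card_cells.
apply: sum_deviation_le => //.
- exact: measurable_ann.
- by move=> F x /= h; rewrite /annulus /= -(label_fst l) h.
- apply/trivIsetP => F G _ _ FG; apply/seteqP; split => // x [/= -> /cell_label_inj FGe].
  by move: FG; rewrite FGe eqxx.
Qed.

Lemma expected_empirical_weight :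
  (\int[P]_w (N%:R^-1 * \sum_(i < N) W (ann (X i w)))%:E =
   \int[mu]_x (W (ann x))%:E)%E.
Proof.
have Ninv : 0 <= (N%:R : R)^-1 by rewrite invr_ge0.
have W0 n : 0 <= W n by rewrite ltW// weight_gt0.
have mW : measurable_fun setT (fun x : eul => (W (ann x))%:E).
  by apply/measurable_EFinP; exact: measurable_weight_ann.
have mWX i : measurable_fun setT (fun w => (W (ann (X i w)))%:E).
  exact: (measurableT_comp mW).
have IX i : (\int[P]_w (W (ann (X i w)))%:E = \int[mu]_x (W (ann x))%:E)%E.
  rewrite -(@eq_measure_integral _ _ _ _ mu (distribution P (X i))).
    rewrite ge0_integral_distribution//.
    by move=> x; rewrite lee_fin.
  by move=> A mA _; exact: (iid.2 i A mA).
under eq_integral do rewrite mulr_sumr -sumEFin.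
rewrite ge0_integral_sum//; last 2 first.
- by move=> i; under eq_fun do rewrite EFinM; exact: measurable_funeM.
- by move=> i w _; rewrite lee_fin mulr_ge0.
under eq_bigr => i _.
  under eq_integral do rewrite EFinM.
  rewrite ge0_integralZl ?lee_fin//; last by move=> w _; rewrite lee_fin.
  rewrite IX; over.
rewrite -ge0_sume_distrl; last by move=> i _; rewrite lee_fin.
rewrite sumEFin sumr_const card_ord -[_ *+ N]mulr_natr mulVf ?mul1e//.
by rewrite pnatr_eq0 -lt0n.
Qed.

(** The bounds of all levels are regrouped by annulus, so that the sum over scales can then be
    estimated for one mass at a time. The factor 2 in the finest term arises because the mean weight
    of the sample equals that of [mu]. *)
Lemma expected_exp_cost_le L :
  (\int[P]_w exp_cost p a mu (empirical (fun i => X i w) N) <=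
   \sum_(n <oo) (W n * (scale_coef L * (2 * fine (mu (@annulus R d n))) +
      \sum_(0 <= l < L) scale_coef l * cell_bound N l.+1 (fine (mu (@annulus R d n))) +
      cell_bound N 0 (fine (mu (@annulus R d n)))))%:E)%E.
Proof.
have Ninv : 0 <= (N%:R : R)^-1 by rewrite invr_ge0.
have W0 n : 0 <= W n by rewrite ltW// weight_gt0.
have e0 l : (0 <= (scale_coef l)%:E)%E by rewrite lee_fin scale_coef_ge0.
pose x n := fine (mu (@annulus R d n)).
have x0 n : 0 <= x n by rewrite fine_ge0.
pose Wx : \bar R := (\sum_(n <oo) (W n * x n)%:E)%E.
pose WT l : \bar R := (\sum_(n <oo) (W n * cell_bound N l (x n))%:E)%E.
have T0 l n : (0 <= (W n * cell_bound N l (x n))%:E)%E.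
  by rewrite lee_fin mulr_ge0// cell_bound_ge0.
have Wx0 n : (0 <= (W n * x n)%:E)%E by rewrite lee_fin mulr_ge0.
have -> : (\sum_(n <oo) (W n * (scale_coef L * (2 * x n) +
      \sum_(0 <= l < L) scale_coef l * cell_bound N l.+1 (x n) +
      cell_bound N 0 (x n)))%:E =
    (scale_coef L)%:E * (Wx + Wx) +
    \sum_(0 <= l < L) (scale_coef l)%:E * WT l.+1 + WT 0%N)%E.
  rewrite /Wx -nneseriesD// -nneseriesZl; last by move=> n _; exact: adde_ge0.
  rewrite (eq_bigr (fun l => \sum_(n <oo) (scale_coef l)%:E *
     (W n * cell_bound N l.+1 (x n))%:E)%E); last by move=> l _; rewrite -nneseriesZl.
  rewrite -nneseries_sum_nat; last by move=> l n; exact: mule_ge0.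
  rewrite -nneseriesD; last 2 first.
  - by move=> n _ _; apply: mule_ge0 => //; exact: adde_ge0.
  - by move=> n _ _; apply: sume_ge0 => l _; exact: mule_ge0.
  rewrite /WT -nneseriesD//; last first.
    move=> n _ _; apply: adde_ge0; first by apply: mule_ge0 => //; exact: adde_ge0.
    by apply: sume_ge0 => l _; exact: mule_ge0.
  apply: eq_eseriesr => n _.
  rewrite -[((W n * x n)%:E + (W n * x n)%:E)%E]EFinD -EFinM sumEFin -!EFinD; congr _%:E.
  rewrite !mulrDr mulr_sumr; congr (_ + _ + _); first by ring.
  by apply: eq_bigr => l _; rewrite mulrCA.
have mlev l := measurable_level_deviation l.
have lev0 l w : (0 <= level_deviation mu (fun i => X i w) N l)%E.
  exact: level_deviation_ge0.
have mWs : measurable_fun setT (fun w => (N%:R^-1 * \sum_(i < N) W (ann (X i w)))%:E).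
  apply/measurable_EFinP; apply: measurable_funM => //.
  apply: measurable_sum => i; exact: (measurableT_comp measurable_weight_ann).
have Ws0 w : (0 <= (N%:R^-1 * \sum_(i < N) W (ann (X i w)))%:E)%E.
  by rewrite lee_fin mulr_ge0// sumr_ge0.
have I0 : (0 <= \int[mu]_x (W (ann x))%:E)%E.
  by apply: integral_ge0 => z _; rewrite lee_fin.
have If : measurable_fun setT (fun w => ((scale_coef L)%:E * (\int[mu]_x (W (ann x))%:E +
       (N%:R^-1 * \sum_(i < N) W (ann (X i w)))%:E))%E).
  by apply: measurable_funeM; apply: emeasurable_funD.
have If0 w : (0 <= (scale_coef L)%:E * (\int[mu]_x (W (ann x))%:E +
       (N%:R^-1 * \sum_(i < N) W (ann (X i w)))%:E))%E.
  by apply: mule_ge0 => //; exact: adde_ge0.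
have Is : measurable_fun setT (fun w => \sum_(0 <= l < L) (scale_coef l)%:E *
    level_deviation mu (fun i => X i w) N l.+1)%E.
  by apply: emeasurable_sum => l; exact: measurable_funeM.
have Is0 w : (0 <= \sum_(0 <= l < L) (scale_coef l)%:E *
    level_deviation mu (fun i => X i w) N l.+1)%E.
  by apply: sume_ge0 => l _; exact: mule_ge0.
apply: (le_trans (ge0_le_integral_nomeas P (fun w => exp_cost_ge0 _ _)
  (fun w => exp_cost_le_levels mu (fun i => X i w) L N0))).
rewrite ge0_integralD//; last 2 first.
- by move=> w _; exact: adde_ge0.
- exact: emeasurable_funD.
rewrite ge0_integralD//; apply: leeD; last exact: expected_level_deviation.
apply: leeD.
  rewrite ge0_integralZl//; last 2 first.
  - exact: emeasurable_funD.
  - by move=> w _; exact: adde_ge0.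
  rewrite lee_wpmul2l// ge0_integralD//.
  by rewrite expected_empirical_weight !integral_weight_ann integral_cst//= probability_setT mule1.
rewrite ge0_integral_sum//; last 2 first.
- by move=> l; exact: measurable_funeM.
- by move=> l w _; exact: mule_ge0.
apply: lee_sum => l _; rewrite ge0_integralZl// lee_wpmul2l//.
exact: expected_level_deviation.
Qed.

End expected_cost.

(** * Rates *)

Section rates.
Context (R : realType) (d : nat) (a p b E : R) (a0 : 0 < a) (p1 : 1 <= p).

(** From one scale to the next finer one the cost shrinks by [r], while the deviation may grow by
    [g], the square root of the number 2^d of subcells. *)
Local Notation r := (2 `^ (- p) : R).
Local Notation g := (2 `^ (d%:R / 2) : R).

Lemma cell_bound_le (N l : nat) (x : R) : (0 < N)%N -> 0 <= x ->
  cell_bound d N l x <= 2 * 2 ^+ d * Num.min x (g ^+ l * Num.sqrt (x / N%:R)).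
Proof.
move=> N0 x0; have xN : 0 <= x / N%:R by rewrite divr_ge0.
have g2 : g ^+ 2 = 2 ^+ d.
  rewrite -[g ^+ 2]powR_mulrn ?powR_ge0// -powRrM -[RHS]powR_mulrn//.
  by congr powR; field.
have sE : Num.sqrt (((2 ^ l.+2) ^ d)%:R * x / N%:R) =
    2 ^+ d * (g ^+ l * Num.sqrt (x / N%:R)).
  have -> : ((2 ^ l.+2) ^ d)%:R * x / N%:R = (2 ^+ d * g ^+ l) ^+ 2 * (x / N%:R) :> R.
    rewrite -mulrA; congr (_ * _); rewrite !natrX [RHS]exprMn.
    rewrite -(exprM g) (mulnC l) (exprM g) g2 -!exprM -exprD.
    by congr (_ ^+ _); rewrite !mulSn muln2 -addnn -addnA (mulnC d l).
  rewrite sqrtrM ?sqr_ge0// sqrtr_sqr ger0_norm; first by rewrite mulrA.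
  by rewrite mulr_ge0 ?exprn_ge0 ?powR_ge0.
rewrite /cell_bound sE minr_pMr ?mulr_ge0 ?exprn_ge0//.
set u := g ^+ l * _; have u0 : 0 <= u by rewrite mulr_ge0 ?exprn_ge0 ?powR_ge0 ?sqrtr_ge0.
have d1 : (1 : R) <= 2 ^+ d by rewrite exprn_ege1// ler1n.
rewrite le_min !ge_min; apply/andP; split; apply/orP; [left|right].
  by rewrite ler_wpM2r// ler_peMr.
by rewrite ler_wpM2r// ler_peMl ?exprn_ge0// ler1n.
Qed.

(** Separates scales from annuli: a bound [rho * x^sg] on the sum over scales, uniform in the mass
    [x], gives the rate [rho], because the weighted series of the masses to the power [sg]
    converges. The condition on [r ^+ L] absorbs the cost of the finest matching. Leaving [L] and
    [rho] free lets both depend on [N], with a logarithm if need be. *)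
Lemma exp_cost_rate (sg C1 : R) : 0 < sg -> sg <= 1 -> 4 `^ p * a < sg * b ->
  0 <= b -> 0 <= C1 ->
  exists C : R, 0 < C /\
    forall (mu : probability (euclid R d) R),
      (\int[mu]_y (expR (b * enorm y `^ p))%:E = E%:E)%E ->
    forall (disp : measure_display) (Omega : measurableType disp)
      (P : probability Omega R) (X : nat -> {RV P >-> euclid R d}),
      iid_with_law X mu ->
    forall (N L : nat) (rho : R), (0 < N)%N -> 0 <= rho -> r ^+ L <= rho ->
      (forall x, 0 <= x <= 1 ->
        \sum_(0 <= l < L.+1) r ^+ l * Num.min x (g ^+ l * Num.sqrt (x / N%:R)) <=
        C1 * (rho * x `^ sg)) ->
      (\int[P]_w exp_cost p a mu (empirical (fun i => X i w) N)
         <= (C * rho)%:E)%E.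
Proof.
move=> sg0 sg1 sgb b0 C10.
have [S [S0 HS]] := @weight_moment_series R d a p b E p1 sg sg0 sgb b0.
pose D : R := Num.sqrt d%:R `^ p.
have D0 : 0 <= D by exact: powR_ge0.
have r0 : 0 < r by rewrite powR_gt0.
pose C0 : R := 2 * 2 ^+ d.
have C00 : 0 <= C0 by rewrite mulr_ge0 ?exprn_ge0.
(* [2 * D] pays for the finest level, [D / r] for the shift between the cost at depth [l] and the
   deviation at depth [l.+1], and 1 for the deviation at depth 0. *)
pose K := 2 * D + (D / r + 1) * (C0 * C1).
have Dr0 : 0 <= D / r by rewrite divr_ge0 ?(ltW r0).
have K0 : 0 <= K by rewrite addr_ge0 ?mulr_ge0 ?addr_ge0.
exists ((K + 1) * S); split; first by rewrite mulr_gt0// ltr_wpDl.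
move=> mu muE disp Omega P X iid N L rho N0 rho0 rL Hsum.
have pointwise x : 0 <= x <= 1 ->
    scale_coef d p L * (2 * x) +
      \sum_(0 <= l < L) scale_coef d p l * cell_bound d N l.+1 x +
      cell_bound d N 0 x <= K * rho * x `^ sg.
  move=> x01; have /andP[x0 x1] := x01.
  have xs : x <= x `^ sg.
    move: x0; rewrite le_eqVlt => /predU1P[<-|x0]; first exact: powR_ge0.
    by rewrite ger1_powR// x0.
  have cb0 l : 0 <= cell_bound d N l x by exact: cell_bound_ge0.
  pose A := \sum_(0 <= l < L.+1) r ^+ l * cell_bound d N l x.
  have AE : A = cell_bound d N 0 x + \sum_(0 <= l < L) r ^+ l.+1 * cell_bound d N l.+1 x.
    by rewrite /A big_nat_recl// expr0 mul1r.
  have tail0 : 0 <= \sum_(0 <= l < L) r ^+ l.+1 * cell_bound d N l.+1 x.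
    by apply: sumr_ge0 => l _; rewrite mulr_ge0 ?exprn_ge0 ?(ltW r0).
  have A1 : A <= C0 * C1 * (rho * x `^ sg).
    apply: (@le_trans _ _ (C0 * \sum_(0 <= l < L.+1)
        r ^+ l * Num.min x (g ^+ l * Num.sqrt (x / N%:R)))).
      rewrite mulr_sumr; apply: ler_sum => l _.
      rewrite [leRHS]mulrCA ler_wpM2l ?exprn_ge0 ?(ltW r0)//.
      exact: cell_bound_le.
    by rewrite -mulrA ler_wpM2l// Hsum.
  have -> : \sum_(0 <= l < L) scale_coef d p l * cell_bound d N l.+1 x =
      D / r * \sum_(0 <= l < L) r ^+ l.+1 * cell_bound d N l.+1 x.
    rewrite mulr_sumr; apply: eq_bigr => l _; rewrite /scale_coef -/D exprS.
    by field; rewrite gt_eqF.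
  have rx : scale_coef d p L * (2 * x) <= 2 * D * rho * x `^ sg.
    rewrite /scale_coef -/D.
    have -> : D * r ^+ L * (2 * x) = 2 * D * (r ^+ L * x) by ring.
    rewrite -[leRHS]mulrA ler_wpM2l ?mulr_ge0//.
    by rewrite ler_pM ?exprn_ge0 ?(ltW r0).
  have part2 : D / r * (\sum_(0 <= l < L) r ^+ l.+1 * cell_bound d N l.+1 x) +
     cell_bound d N 0 x <= (D / r + 1) * A.
    rewrite AE mulrDl mul1r mulrDr.
    have := mulr_ge0 Dr0 (cb0 0%N); lra.
  have Dr1 : 0 <= D / r + 1 by rewrite addr_ge0.
  have := ler_wpM2l Dr1 A1.
  rewrite -addrA /K.
  have -> : (2 * D + (D / r + 1) * (C0 * C1)) * rho * x `^ sg =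
    2 * D * rho * x `^ sg + (D / r + 1) * (C0 * C1 * (rho * x `^ sg)) by ring.
  by move=> h; exact: lerD rx (le_trans part2 h).
have W0 n : 0 <= weight a p n by rewrite ltW// weight_gt0.
have x01 n : 0 <= fine (mu (@annulus R d n)) <= 1.
  have mA : measurable (@annulus R d n) by exact: measurable_ann.
  by rewrite fine_ge0//= -lee_fin fineK ?fin_num_measure// probability_le1.
apply: (le_trans (expected_exp_cost_le a0 p1 iid N0 L)).
apply: (@le_trans _ _ (\sum_(n <oo) (K * rho)%:E *
    (weight a p n * fine (mu (@annulus R d n)) `^ sg)%:E)%E).
  apply: lee_nneseries => [n _ _|n _].
    have /andP[xn0 _] := x01 n.
    rewrite lee_fin mulr_ge0// !addr_ge0 ?mulr_ge0 ?scale_coef_ge0 ?cell_bound_ge0//.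
    by apply: sumr_ge0 => l _; rewrite mulr_ge0 ?scale_coef_ge0 ?cell_bound_ge0.
  by rewrite -EFinM lee_fin [leRHS]mulrCA ler_wpM2l// pointwise.
rewrite nneseriesZl; last by move=> n _; rewrite lee_fin mulr_ge0 ?powR_ge0.
apply: (le_trans (lee_wpmul2l _ (HS mu muE))).
  by rewrite lee_fin mulr_ge0.
rewrite -EFinM lee_fin mulrAC ler_wpM2r// ler_wpM2r ?(ltW S0)//.
by rewrite lerDl.
Qed.

End rates.

(** * Choice of the finest scale *)

Section depth.
Context (R : realType).

(** Deep enough that [2 ^ depth N] exceeds [N], so the finest cells cost less than any rate
    considered, yet only logarithmic in [N]. *)
Definition depth (N : nat) : nat := (trunc_log 2 N).+1.

Lemma depth_scale (p tau : R) (N : nat) : (0 < N)%N -> 1 <= p -> tau <= 1 ->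
  (2 `^ (- p)) ^+ depth N <= (N%:R : R) `^ (- tau).
Proof.
move=> N0 p1 t1; have N1 : 1 <= (N%:R : R) by rewrite ler1n.
apply: (@le_trans _ _ ((N%:R : R)^-1)); last first.
  by rewrite -powR_inv1 ?ler_powR ?lerN2// (le_trans _ N1).
apply: (@le_trans _ _ ((2 ^+ depth N)^-1)).
  rewrite -exprVn lerXn2r ?nnegrE ?powR_ge0 ?invr_ge0//.
  by rewrite -powR_inv1// ler_powR ?ler1n// lerN2.
rewrite lef_pV2 ?posrE ?exprn_gt0 ?ltr0n// -natrX ler_nat.
by have /andP[_ /ltnW] := trunc_log_bounds (isT : (1 < 2)%N) N0.
Qed.

(** The left side is [trunc_log 2 N + 2]; since [N >= 1], the binary logarithm of [N + 1] is at
    least 1, which gives the factor 3. *)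
Lemma depth_log (N : nat) : (0 < N)%N ->
  ((depth N).+1%:R : R) <= 3 * (ln (N.+1)%:R / ln 2).
Proof.
move=> N0; have ln2 : 0 < ln (2 : R) by rewrite ln_gt0// ltr1n.
have h1 : (1 : R) <= ln (N.+1)%:R / ln 2.
  by rewrite ler_pdivlMr// mul1r ler_ln ?posrE ?ltr0n// ler_nat ltnS.
have h2 : ((trunc_log 2 N)%:R : R) <= ln (N.+1)%:R / ln 2.
  rewrite ler_pdivlMr// mulr_natl -lnXn// ler_ln ?posrE ?ltr0n ?exprn_gt0//.
  rewrite -natrX ler_nat ltnW// ltnS.
  by have /andP[] := trunc_log_bounds (isT : (1 < 2)%N) N0.
by rewrite /depth -addn2 natrD; lra.
Qed.

Lemma scale_ratio_lt1 (d : nat) (p tau : R) : d%:R * tau < p ->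
  2 `^ (- p) * (2 `^ (d%:R / 2)) `^ (2 * tau) < (1 : R).
Proof.
move=> h; rewrite -powRrM -powRD; last by rewrite pnatr_eq0 implybT.
rewrite (_ : - p + d%:R / 2 * (2 * tau) = - (p - d%:R * tau)); last by field.
rewrite powRN invf_lt1 ?powR_gt0//.
have e1 : (1 : R) `^ (p - d%:R * tau) = 1 by rewrite powR1.
by rewrite -[ltLHS]e1 gt0_ltr_powR ?nnegrE ?subr_gt0// ltr1n.
Qed.

End depth.

(** * The three regimes of (a), and (b) *)

Theorem mainTheorem4 (R : realType) (d : nat) (p a b E : R)
    (hd : (1 <= d)%N) (ha : 0 < a) (hp : 1 <= p) (hb : 4 `^ p * a < b) :
  ((d%:R / 2 <= p -> 2 `^ (2 * p + 1) * a < b) ->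
   (p < d%:R / 2 -> 4 `^ p * d%:R * a / (d%:R - p) < b) ->
   exists C : R, 0 < C /\
     forall (mu : probability (euclid R d) R),
       (\int[mu]_y (expR (b * enorm y `^ p))%:E = E%:E)%E ->
     forall (disp : measure_display) (Omega : measurableType disp)
       (P : probability Omega R) (X : nat -> {RV P >-> euclid R d}),
       iid_with_law X mu ->
     forall N : nat, (1 <= N)%N ->
       (\int[P]_w exp_cost p a mu (empirical (fun i => X i w) N)
         <= (C * rate d p N)%:E)%E)
  /\
  ((d%:R / 2 <= p -> b <= 2 `^ (2 * p + 1) * a) ->
   (p < d%:R / 2 -> b <= 4 `^ p * d%:R * a / (d%:R - p)) ->
   forall eps : R, 0 < eps -> eps < 1 - 4 `^ p * a / b ->
   exists C : R, 0 < C /\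
     forall (mu : probability (euclid R d) R),
       (\int[mu]_y (expR (b * enorm y `^ p))%:E = E%:E)%E ->
     forall (disp : measure_display) (Omega : measurableType disp)
       (P : probability Omega R) (X : nat -> {RV P >-> euclid R d}),
       iid_with_law X mu ->
     forall N : nat, (1 <= N)%N ->
       (\int[P]_w exp_cost p a mu (empirical (fun i => X i w) N)
         <= (C * N%:R `^ (- (1 - 4 `^ p * a / b - eps)))%:E)%E).
Proof.
have d0 : 0 < (d%:R : R) by rewrite ltr0n.
have p0 : 0 < p by rewrite (lt_le_trans _ hp).
have A0 : 0 < 4 `^ p * a by rewrite mulr_gt0// powR_gt0.
have b0 : 0 < b by exact: lt_trans hb.
have pow24 : 2 `^ (2 * p + 1) * a = 2 * (4 `^ p * a).
  rewrite powRD; last by rewrite pnatr_eq0 implybT.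
  rewrite powRr1// powRrM (_ : 2 `^ 2 = 4); first by ring.
  by rewrite (powR_mulrn 2%N)//; ring.
rewrite pow24 => {pow24}.
(* The noncritical interpolation, with rate N^(-tau) and mass exponent 1 - tau. It serves (a) for p
   > d/2 with tau = 1/2, and the whole of (b). *)
have interp tau : 0 < tau -> tau <= 2^-1 -> d%:R * tau < p ->
    4 `^ p * a < (1 - tau) * b ->
    exists C : R, 0 < C /\
     forall (mu : probability (euclid R d) R),
       (\int[mu]_y (expR (b * enorm y `^ p))%:E = E%:E)%E ->
     forall (disp : measure_display) (Omega : measurableType disp)
       (P : probability Omega R) (X : nat -> {RV P >-> euclid R d}),
       iid_with_law X mu ->
     forall N : nat, (1 <= N)%N ->
       (\int[P]_w exp_cost p a mu (empirical (fun i => X i w) N)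
         <= (C * N%:R `^ (- tau))%:E)%E.
  move=> t0 t1 dt tb; have rg := scale_ratio_lt1 dt.
  have sg0 : 0 < 1 - tau by lra.
  have sg1 : 1 - tau <= 1 by lra.
  have C10 : 0 <= (1 - 2 `^ (- p) * (2 `^ (d%:R / 2)) `^ (2 * tau))^-1.
    by rewrite invr_ge0 subr_ge0 ltW.
  have [C [C0 HC]] := exp_cost_rate d E ha hp sg0 sg1 tb (ltW b0) C10.
  exists C; split => // mu muE disp O P X iid N N0.
  apply: (HC mu muE disp O P X iid N (depth N)) => //.
  - by apply: depth_scale => //; lra.
  - move=> x /andP[x0 x1]; apply: scale_sum_interpolation; rewrite ?powR_gt0//.
    exact: ltW.
split.
  move=> H1 H2; have [pd|pd|pd] := ltgtP p (d%:R / 2).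
  (* The exponent q = 2p/d solves g^(-q) = r for g = 2^(d/2) and r = 2^(-p), and q/2 is the rate
     p/d. *)
  - have q0 : 0 < 2 * p / d%:R < 1.
      by rewrite divr_gt0 ?mulr_gt0//= ltr_pdivrMr// mul1r; lra.
    have g1 : 1 < 2 `^ (d%:R / 2) :> R.
      have e1 : (1 : R) `^ (d%:R / 2) = 1 by rewrite powR1.
      by rewrite -[ltLHS]e1 gt0_ltr_powR ?nnegrE ?divr_gt0// ltr1n.
    have rE : 2 `^ (- p) = (2 `^ (d%:R / 2)) `^ (- (2 * p / d%:R)) :> R.
      by rewrite -powRrM; congr powR; field; rewrite gt_eqF.
    have [C1 [C10 HC1]] := scale_sum_supercritical g1 q0 rE.
    have qE : 2 * p / d%:R / 2 = p / d%:R by field; rewrite gt_eqF.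
    have pd1 : p / d%:R < 1 by rewrite ltr_pdivrMr// mul1r; lra.
    have sgb : 4 `^ p * a < (1 - p / d%:R) * b.
      have := H2 pd; rewrite ltr_pdivrMr; last by lra.
      rewrite (_ : 4 `^ p * d%:R * a = 4 `^ p * a * d%:R); last by ring.
      rewrite -ltr_pdivlMr// => /lt_le_trans; apply.
      by rewrite le_eqVlt; apply/orP; left; apply/eqP; field; rewrite gt_eqF.
    have sg0 : 0 < 1 - p / d%:R by lra.
    have sg1 : 1 - p / d%:R <= 1 by rewrite gerBl divr_ge0 ?ltW.
    have [C [C0 HC]] := exp_cost_rate d E ha hp sg0 sg1 sgb (ltW b0) (ltW C10).
    exists C; split => // mu muE disp O P X iid N N0.
    rewrite /rate ltNge (ltW pd) /= lt_eqF//.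
    apply: (HC mu muE disp O P X iid N (depth N)) => //.
    + by apply: depth_scale => //; lra.
    + by move=> x /andP[x0 x1]; rewrite -qE; exact: HC1.
  - have t0 : 0 < 2^-1 :> R by rewrite invr_gt0.
    have dt : d%:R * 2^-1 < p by [].
    have tb : 4 `^ p * a < (1 - 2^-1) * b by have := H1 (ltW pd); lra.
    have [C [C0 HC]] := interp 2^-1 t0 (lexx _) dt tb.
    exists C; split => // mu muE disp O P X iid N N0.
    by rewrite /rate pd mul1r; exact: HC.
  - have sgb : 4 `^ p * a < (1 - 2^-1) * b.
      by have := H1; rewrite pd lexx => /(_ isT); lra.
    have sg0 : 0 < 1 - 2^-1 :> R by lra.
    have sg1 : 1 - 2^-1 <= 1 :> R by lra.
    (* Critical case: [C1] is the 3 of [depth_log], and [rho] will be the binary logarithm of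
       [N + 1] times N^(-1/2); the division of [C] by [ln 2] below returns to the natural
       logarithm. *)
    have [C [C0 HC]] := exp_cost_rate d E ha hp sg0 sg1 sgb (ltW b0) (ler0n R 3).
    have ln2 : 0 < ln (2 : R) by rewrite ln_gt0// ltr1n.
    exists (C / ln 2); split; first by rewrite divr_gt0.
    move=> mu muE disp O P X iid N N0.
    have lnN : 1 <= ln (N.+1)%:R / ln 2 :> R.
      by rewrite ler_pdivlMr// mul1r ler_ln ?posrE ?ltr0n// ler_nat ltnS.
    have lnN0 : 0 <= ln (N.+1)%:R / ln 2 :> R by exact: le_trans lnN.
    have -> : rate d p N = ln (N.+1)%:R * N%:R `^ (- 2^-1).
      by rewrite /rate pd ltxx eqxx mul1r.
    rewrite (_ : C / ln 2 * (ln N.+1%:R * N%:R `^ (- 2^-1)) =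
      C * (ln N.+1%:R / ln 2 * N%:R `^ (- 2^-1))); last by field; rewrite gt_eqF.
    apply: (HC mu muE disp O P X iid N (depth N) _ N0).
    + by rewrite mulr_ge0 ?powR_ge0.
    + apply: (@le_trans _ _ (N%:R `^ (- 2^-1))).
        by apply: depth_scale => //; lra.
      by rewrite ler_peMl ?powR_ge0.
    + move=> x /andP[x0 x1].
      apply: (le_trans (scale_sum_critical _ _ _ _ x0)).
      * exact: powR_gt0.
      * rewrite pd -powRD ?addNr ?powRr0//.
        by rewrite pnatr_eq0 implybT.
      * rewrite !mulrA ler_wpM2r ?powR_ge0// ler_wpM2r ?powR_ge0//.
        by rewrite -mulrA; exact: depth_log.
move=> H1 H2 eps eps0 eps1.
have ab : 4 `^ p * a = (4 `^ p * a / b) * b by rewrite mulfVK// gt_eqF.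
have tau0 : 0 < 1 - 4 `^ p * a / b - eps by lra.
(* For tau = 1 - 4^p a/b - eps, (1 - tau) b equals 4^p a + eps b. *)
have tb : 4 `^ p * a < (1 - (1 - 4 `^ p * a / b - eps)) * b.
  rewrite {1}ab ltr_pM2r//; lra.
have [dp|pd] := leP (d%:R / 2) p.
  (* The upper bound on [b] gives tau < 1/2, hence d tau < d/2 <= p. *)
  have ab2 : 2^-1 <= 4 `^ p * a / b by rewrite ler_pdivlMr//; have := H1 dp; lra.
  apply: interp => //; first lra.
  apply: (lt_le_trans _ dp); rewrite ltr_pM2l//; lra.
(* Here the upper bound on [b] gives tau < p/d, which is below 1/2. *)
have abd : 1 - p / d%:R <= 4 `^ p * a / b.
  have := H2 pd; rewrite ler_pdivlMr; last by lra.
  rewrite ler_pdivlMr// => h.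
  rewrite -(ler_pM2r d0) (_ : (1 - p / d%:R) * b * d%:R = b * (d%:R - p)).
    by rewrite (le_trans h)// le_eqVlt; apply/orP; left; apply/eqP; ring.
  by field; rewrite gt_eqF.
have pd2 : p / d%:R < 2^-1 by rewrite ltr_pdivrMr//; lra.
apply: interp => //; first lra.
rewrite mulrC -ltr_pdivlMr//; lra.
Qed.
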